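(* Suppose Assumptions 1, 2, 3 and 4 (stated in the context) hold, and let $\{(\boldsymbol{x}_{i,t},\boldsymbol{y}_{i,t})\}$ be generated by Algorithm DOSMD-CCO (described in the context). Then, for $T\ge 2$ and any $j\in\mathcal V$, $$\textbf{ESP-Regret}_d^j(T)\le I_1+\frac{\Gamma}{1-\sigma}I_2+\Big(I_3+\frac{\Gamma}{1-\sigma}I_4\Big)\sum_{t=1}^{T}\alpha_t+\Big(I_5+\frac{\Gamma}{1-\sigma}I_6\Big)\sum_{t=1}^{T}\eta_t+\frac{nR_X}{\alpha_T}+\frac{nR_Y}{\eta_T}$$ $$\qquad+\,nK_X\sum_{t=1}^T\frac{1}{\alpha_t}\|\boldsymbol{x}_{t+1}^*-B_t\boldsymbol{x}_t^*\|+nK_Y\sum_{t=1}^T\frac{1}{\eta_t}\|\boldsymbol{y}_{t+1}^*-C_t\boldsymbol{y}_t^*\|,$$ where $I_1=(n+2)\sum_{i=1}^n\big(L_X\|\boldsymbol{x}_{i,1}-\boldsymbol{x}_{avg,1}\|+L_Y\|\boldsymbol{y}_{i,1}-\boldsymbol{y}_{avg,1}\|\big)$, $I_2=n(n+2)\sum_{i=1}^n\big(L_X\|\boldsymbol{x}_{i,1}\|+L_Y\|\boldsymbol{y}_{i,1}\|\big)$, $I_3=\frac{nL_X^2}{\varrho_x}$, $I_4=\frac{n^2(n+2)L_X^2}{\varrho_x}$, $I_5=\frac{nL_Y^2}{\varrho_y}$, $I_6=\frac{n^2(n+2)L_Y^2}{\varrho_y}$, $R_X=\max_{\boldsymbol{x},\boldsymbol{u}\in\boldsymbol{X}}\Psi_{\mathcal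 R}^x(\boldsymbol{x},\boldsymbol{u})$, $R_Y=\max_{\boldsymbol{y},\boldsymbol{z}\in\boldsymbol{Y}}\Psi_{\mathcal R}^y(\boldsymbol{y},\boldsymbol{z})$.
   Context: **Problem.** $[m]=\{1,\dots,m\}$; $\|\cdot\|$ is a norm (on $\mathbb R^d$, resp. $\mathbb R^m$), $\|\cdot\|_*$ its dual norm, and matrix norms are the induced operator norms. $\boldsymbol{X}\subset\mathbb R^d$, $\boldsymbol{Y}\subset\mathbb R^m$ are convex compact sets with diameters (in $\|\cdot\|$) at most $M_X>0$, $M_Y>0$. For agents $i\in\mathcal V=[n]$ and times $t\ge1$, $f_{i,t}:\mathbb R^d\times\mathbb R^m\to\mathbb R$ is convex in the first and concave in the second argument; $f_t=\sum_{i=1}^n f_{i,t}$. For each $t$, $(\boldsymbol{x}_t^*,\boldsymbol{y}_t^* )\in\boldsymbol{X}\times\boldsymbol{Y}$ is a saddle point of $f_t$: $f_t(\boldsymbol{x}_t^*,\boldsymbol{y})\le f_t(\boldsymbol{x}_t^*,\boldsymbol{y}_t^* )\le f_t(\boldsymbol{x},\boldsymbol{y}_t^* )$ for all $\boldsymbol{x}\in\boldsymbol{X},\boldsymbol{y}\in\boldsymbol{Y}$. The expected dynamic saddle point regret of agent $j$ is $$\textbf{ESP-Regret}_d^j(T)=\Big|\mathbb E\Big[\sum_{t=1}^T f_t(\boldsymbol{x}_{j,t},\boldsymbol{y}_{j,t})-\sum_{t=1}^T f_t(\boldsymbol{x}_t^*,\boldsymbol{y}_t^* )\Big]\Big|.$$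 **Network.** $\mathcal G_t=(\mathcal V,\mathcal E_t,A_t)$ is a directed time-varying graph with doubly stochastic weight matrix $A_t\in\mathbb R^{n\times n}$; $\mathcal N_i^{in}(t)=\{i\}\cup\{j:(j,i)\in\mathcal E_t\}$; for a fixed $0<\zeta<1$, $[A_t]_{ij}>\zeta$ if $j\in\mathcal N_i^{in}(t)$ and $[A_t]_{ij}=0$ otherwise. **Bregman divergences.** $\mathcal R^x:\mathbb R^d\to\mathbb R$, $\mathcal R^y:\mathbb R^m\to\mathbb R$ are differentiable and respectively $\varrho_x$- and $\varrho_y$-strongly convex (w.r.t. $\|\cdot\|$) on $\boldsymbol{X}$, $\boldsymbol{Y}$; $\Psi_{\mathcal R}^x(\boldsymbol{x}_a,\boldsymbol{x}_b)=\mathcal R^x(\boldsymbol{x}_a)-\mathcal R^x(\boldsymbol{x}_b)-\langle\nabla\mathcal R^x(\boldsymbol{x}_b),\boldsymbol{x}_a-\boldsymbol{x}_b\rangle$, and $\Psi_{\mathcal R}^y$ is defined analogously from $\mathcal R^y$. Thus $\Psi_{\mathcal R}^x(\boldsymbol{x}_a,\boldsymbol{x}_b)\ge\frac{\varrho_x}{2}\|\boldsymbol{x}_a-\boldsymbol{x}_b\|^2$ on $\boldsymbol{X}$, and likewise for $y$ on $\boldsymbol{Y}$. **Algorithm DOSMD-CCO.** Given initial decisions $\boldsymbol{x}_{i,1}\in\boldsymbol{X},\boldsymbol{y}_{i,1}\in\boldsymbol{Y}$, step sizes $\alpha_t,\eta_t>0$, and prediction matrices $B_t\in\mathbb R^{d\times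 d}$, $C_t\in\mathbb R^{m\times m}$. At each $t=1,\dots,T$, each agent $i$: (1) obtains stochastic gradients $\widetilde\nabla_{i,t}^x=\widetilde\nabla_{i,t}^x(\boldsymbol{x}_{i,t},\boldsymbol{y}_{i,t})$, $\widetilde\nabla_{i,t}^y=\widetilde\nabla_{i,t}^y(\boldsymbol{x}_{i,t},\boldsymbol{y}_{i,t})$ (from two independent stochastic oracles) and finds $\boldsymbol{z}_{i,t},\boldsymbol{v}_{i,t}$ with $\nabla\mathcal R^x(\boldsymbol{z}_{i,t})=\nabla\mathcal R^x(\boldsymbol{x}_{i,t})-\alpha_t\widetilde\nabla_{i,t}^x$, $\nabla\mathcal R^y(\boldsymbol{v}_{i,t})=\nabla\mathcal R^y(\boldsymbol{y}_{i,t})+\eta_t\widetilde\nabla_{i,t}^y$; (2) sets $\tilde{\boldsymbol{x}}_{i,t}=\arg\min_{\boldsymbol{x}\in\boldsymbol{X}}\Psi_{\mathcal R}^x(\boldsymbol{x},\boldsymbol{z}_{i,t})$, $\tilde{\boldsymbol{y}}_{i,t}=\arg\min_{\boldsymbol{y}\in\boldsymbol{Y}}\Psi_{\mathcal R}^y(\boldsymbol{y},\boldsymbol{v}_{i,t})$; (3) sets $\boldsymbol{s}_{i,t}^x=B_t\tilde{\boldsymbol{x}}_{i,t}$, $\boldsymbol{s}_{i,t}^y=C_t\tilde{\boldsymbol{y}}_{i,t}$; (4) sets $\boldsymbol{x}_{i,t+1}=\sum_{j\in\mathcal N_i^{in}(t)}[A_t]_{ij}\boldsymbol{s}_{j,t}^x$,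 $\boldsymbol{y}_{i,t+1}=\sum_{j\in\mathcal N_i^{in}(t)}[A_t]_{ij}\boldsymbol{s}_{j,t}^y$. Write $\boldsymbol{x}_{avg,t}=\frac1n\sum_{i}\boldsymbol{x}_{i,t}$, $\boldsymbol{y}_{avg,t}=\frac1n\sum_i\boldsymbol{y}_{i,t}$. $\mathcal F_t$ is the $\sigma$-field of the entire history of random variables up to time $t$. **Assumption 1.** There is a positive integer $Q$ such that for all integers $k\ge0$ the graph $(\mathcal V,\bigcup_{i=kQ+1}^{(k+1)Q}\mathcal E_i)$ is strongly connected. Set $\Gamma=(1-\zeta/(4n^2))^{(1-2Q)/Q}$, $\sigma=(1-\zeta/(4n^2))^{1/Q}$. **Assumption 2.** For all $\boldsymbol{x}\in\boldsymbol{X},\boldsymbol{y}\in\boldsymbol{Y}$: $\mathbb E[\widetilde\nabla_{i,t}^x(\boldsymbol{x},\boldsymbol{y})|\mathcal F_{t-1}]=\nabla_xf_{i,t}(\boldsymbol{x},\boldsymbol{y})$, $\mathbb E[\widetilde\nabla_{i,t}^y(\boldsymbol{x},\boldsymbol{y})|\mathcal F_{t-1}]=\nabla_yf_{i,t}(\boldsymbol{x},\boldsymbol{y})$, $\mathbb E[\|\widetilde\nabla_{i,t}^x(\boldsymbol{x},\boldsymbol{y})\|_*^2|\mathcal F_{t-1}]\le L_X^2$, $\mathbb E[\|\widetilde\nabla_{i,t}^y(\boldsymbol{x},\boldsymbol{y})\|_*^2|\mathcal F_{t-1}]\le L_Y^2$. **Assumption 3.** (i) For all $\boldsymbol{x}_a,\boldsymbol{x}_b,\boldsymbol{x}_c\in\boldsymbol{X}$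 and $\boldsymbol{y}_a,\boldsymbol{y}_b,\boldsymbol{y}_c\in\boldsymbol{Y}$: $|\Psi_{\mathcal R}^x(\boldsymbol{x}_a,\boldsymbol{x}_c)-\Psi_{\mathcal R}^x(\boldsymbol{x}_b,\boldsymbol{x}_c)|\le K_X\|\boldsymbol{x}_a-\boldsymbol{x}_b\|$, $|\Psi_{\mathcal R}^y(\boldsymbol{y}_a,\boldsymbol{y}_c)-\Psi_{\mathcal R}^y(\boldsymbol{y}_b,\boldsymbol{y}_c)|\le K_Y\|\boldsymbol{y}_a-\boldsymbol{y}_b\|$. (ii) For all $\boldsymbol{x},\boldsymbol{z}_i\in\mathbb R^d$, $\boldsymbol{y},\boldsymbol{v}_i\in\mathbb R^m$ and all $\boldsymbol{s}$ in the probability simplex of $\mathbb R^n$: $\Psi_{\mathcal R}^x(\boldsymbol{x},\sum_i[\boldsymbol{s}]_i\boldsymbol{z}_i)\le\sum_i[\boldsymbol{s}]_i\Psi_{\mathcal R}^x(\boldsymbol{x},\boldsymbol{z}_i)$ and $\Psi_{\mathcal R}^y(\boldsymbol{y},\sum_i[\boldsymbol{s}]_i\boldsymbol{v}_i)\le\sum_i[\boldsymbol{s}]_i\Psi_{\mathcal R}^y(\boldsymbol{y},\boldsymbol{v}_i)$. **Assumption 4.** For all $t\in[T]$, $\boldsymbol{x}_a,\boldsymbol{x}_b\in\boldsymbol{X}$, $\boldsymbol{y}_a,\boldsymbol{y}_b\in\boldsymbol{Y}$: $\Psi_{\mathcal R}^x(B_t\boldsymbol{x}_a,B_t\boldsymbol{x}_b)\le\Psi_{\mathcal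 R}^x(\boldsymbol{x}_a,\boldsymbol{x}_b)$, $\Psi_{\mathcal R}^y(C_t\boldsymbol{y}_a,C_t\boldsymbol{y}_b)\le\Psi_{\mathcal R}^y(\boldsymbol{y}_a,\boldsymbol{y}_b)$; $\|B_t\|\le1$, $\|C_t\|\le1$; and $B_t\boldsymbol{x}\in\boldsymbol{X}$, $C_t\boldsymbol{y}\in\boldsymbol{Y}$ whenever $\boldsymbol{x}\in\boldsymbol{X}$, $\boldsymbol{y}\in\boldsymbol{Y}$.
   Formalization: The step sizes α_t and η_t are additionally assumed nonincreasing on [1,T] (the bound fails for merely positive step sizes), and Assumption 2 is required at the current decisions (x_{i,t}, y_{i,t}) as well as at every fixed point of X×Y. *)

(* Defs.v *)
From HB Require Import structures.
From mathcomp Require Export all_boot all_order all_algebra.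
From mathcomp Require Export all_classical all_reals all_analysis.

Export Order.TTheory GRing.Theory Num.Theory.
Export numFieldNormedType.Exports.

#[export] Set Implicit Arguments.
#[export] Unset Strict Implicit.
#[export] Unset Printing Implicit Defensive.

Local Open Scope classical_set_scope.
Local Open Scope ring_scope.

Section Vectors.
Context {R : realType} {d : nat}.
Implicit Types (N : 'cV[R]_d -> R) (h : 'cV[R]_d -> R) (X : set 'cV[R]_d).

Definition dotv (a b : 'cV[R]_d) : R := \sum_(k < d) a k 0 * b k 0.

(* The norm is an arbitrary one.  The canonical (sup) norm of 'cV[R]_d is used
   only for compactness and differentiability, which do not depend on the
   choice of a norm in finite dimension. *)
Record is_norm N : Prop := IsNorm {
  normD : forall a b, N (a + b) <= N a + N b ;
  normZ : forall (c : R) a, N (c *: a) = `|c| * N a ;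
  norm_eq0 : forall a, N a = 0 -> a = 0 }.

Definition dual_norm N (g : 'cV[R]_d) : R :=
  sup [set dotv g a | a in [set a | N a <= 1]].

Definition op_norm N (B : 'M[R]_d) : R :=
  sup [set N (B *m a) | a in [set a | N a <= 1]].

Definition diam_le N X (M : R) : Prop :=
  forall a b, X a -> X b -> N (a - b) <= M.

Definition grad h (a : 'cV[R]_d) : 'cV[R]_d :=
  \col_(k < d) 'D_(delta_mx k 0) (h : 'cV[R]_d -> R^o) a.

Definition differentiable_at h (a : 'cV[R]_d) : Prop :=
  differentiable (h : 'cV[R]_d -> R^o) a.

Definition convex_on_space h : Prop :=
  convex_function [set: convex_lmodType 'cV[R]_d] h.

Definition strongly_convex N X (rho : R) h : Prop :=
  forall (l : R) a b, 0 <= l -> l <= 1 -> X a -> X b ->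
    h (l *: a + (1 - l) *: b)
      <= l * h a + (1 - l) * h b - rho / 2 * l * (1 - l) * N (a - b) ^+ 2.

Definition bregman h (a b : 'cV[R]_d) : R :=
  h a - h b - dotv (grad h b) (a - b).

(* The maximum of the divergence over X x X: the supremum is attained when X is
   compact and nonempty and h satisfies bregman_lipschitz on X and
   bregman_convex_right with at least two points. *)
Definition bregman_max h X : R :=
  sup [set bregman h p.1 p.2 | p in X `*` X].

Definition bregman_lipschitz N X h (K : R) : Prop :=
  forall a b c, X a -> X b -> X c ->
    `|bregman h a c - bregman h b c| <= K * N (a - b).

Definition in_simplex {n} (s : 'I_n -> R) : Prop :=
  (forall i, 0 <= s i) /\ \sum_(i < n) s i = 1.

Definition bregman_convex_right (n : nat) h : Prop :=
  forall (a : 'cV[R]_d) (z : 'I_n -> 'cV[R]_d) (s : 'I_n -> R),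
    in_simplex s ->
    bregman h a (\sum_(i < n) s i *: z i)
      <= \sum_(i < n) s i * bregman h a (z i).

Record good_prediction N X h (B : 'M[R]_d) : Prop := GoodPrediction {
  bregman_nonexpansive : forall a b, X a -> X b ->
    bregman h (B *m a) (B *m b) <= bregman h a b ;
  op_norm_le1 : op_norm N B <= 1 ;
  prediction_stable : forall a, X a -> X (B *m a) }.

Definition is_argmin X (F : 'cV[R]_d -> R) (a : 'cV[R]_d) : Prop :=
  X a /\ forall b, X b -> F a <= F b.

End Vectors.

Definition saddle_point {R : realType} {d m : nat}
    (X : set 'cV[R]_d) (Y : set 'cV[R]_m) (F : 'cV[R]_d -> 'cV[R]_m -> R)
    (xs : 'cV[R]_d) (ys : 'cV[R]_m) : Prop :=
  [/\ X xs, Y ys &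
      forall x y, X x -> Y y -> F xs y <= F xs ys /\ F xs ys <= F x ys].

Section Network.
Context {R : realType} {n : nat}.
(* E t j i means that (j, i) is an edge at time t: agent i hears agent j. *)
Implicit Types (E : nat -> rel 'I_n) (A : nat -> 'M[R]_n).

Definition in_neighbours E (t : nat) (i : 'I_n) : {set 'I_n} :=
  [set j | (j == i) || E t j i]%SET.

Definition doubly_stochastic (W : 'M[R]_n) : Prop :=
  [/\ forall i j, 0 <= W i j,
      forall i, \sum_(j < n) W i j = 1 &
      forall j, \sum_(i < n) W i j = 1].

Definition weighted_network E A (zeta : R) : Prop :=
  forall t, (1 <= t)%N ->
    doubly_stochastic (A t) /\
    forall i j, (j \in in_neighbours E t i -> zeta < A t i j) /\
                (j \notin in_neighbours E t i -> A t i j = 0).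

(* The s-th member of the k-th window, s = 0, ..., Q - 1, is time k Q + s + 1. *)
Definition jointly_connected E (Q : nat) : Prop :=
  forall (k : nat) (i j : 'I_n),
    connect (fun u v => [exists s : 'I_Q, E (k * Q + s).+1 u v]) i j.

End Network.

Section Probability.
Context {R : realType} {disp : measure_display} {Omega : measurableType disp}.
Variable P : probability Omega R.

Definition random_vector {d} (Z : Omega -> 'cV[R]_d) : Prop :=
  forall k, measurable_fun [set: Omega] (fun w => Z w k 0).

Definition events_of {d} (Z : Omega -> 'cV[R]_d) : set (set Omega) :=
  \bigcup_(k : 'I_d)
    preimage_set_system [set: Omega] (fun w => Z w k 0) measurable.

(* W is a version of E[Z | G], G being a sub-sigma-algebra. *)
Definition is_cond_exp (G : set (set Omega)) (Z W : Omega -> R) : Prop :=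
  [/\ P.-integrable [set: Omega] (EFin \o Z),
      P.-integrable [set: Omega] (EFin \o W),
      forall B, measurable B -> G (W @^-1` B) &
      forall A, G A ->
        (\int[P]_(w in A) (Z w)%:E = \int[P]_(w in A) (W w)%:E)%E].

(* E[g | G] = gr and E[ ||g||_*^2 | G] <= L^2. *)
Definition unbiased_bounded {d} (N : 'cV[R]_d -> R) (G : set (set Omega))
    (g gr : Omega -> 'cV[R]_d) (L : R) : Prop :=
  (forall k, is_cond_exp G (fun w => g w k 0) (fun w => gr w k 0)) /\
  exists V : Omega -> R,
    is_cond_exp G (fun w => dual_norm N (g w) ^+ 2) V /\
    {ae P, forall w, V w <= L ^+ 2}.

End Probability.

Section Algorithm.
Context {R : realType} {disp : measure_display} {Omega : measurableType disp}.
Context {n : nat}.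

(* The processes produced by the algorithm on one of its two sides; on the
   x-side the fields are x_{i,t}, z_{i,t}, \tilde x_{i,t} and s^x_{i,t}. *)
Record iterates (d : nat) := Iterates {
  decision : 'I_n -> nat -> Omega -> 'cV[R]_d ;
  mirrored : 'I_n -> nat -> Omega -> 'cV[R]_d ;
  projected : 'I_n -> nat -> Omega -> 'cV[R]_d ;
  predicted : 'I_n -> nat -> Omega -> 'cV[R]_d }.

(* The mirror step follows the direction u: minus the stochastic gradient on
   the x-side, plus the stochastic gradient on the y-side. *)
Record mirror_run {d} (X : set 'cV[R]_d) (h : 'cV[R]_d -> R)
    (E : nat -> rel 'I_n) (A : nat -> 'M[R]_n) (B : nat -> 'M[R]_d)
    (step : nat -> R) (T : nat) (init : 'I_n -> 'cV[R]_d)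
    (u : 'I_n -> nat -> Omega -> 'cV[R]_d) (p : iterates d) : Prop := MirrorRun {
  run_init : forall i w, decision p i 1 w = init i ;
  run_mirror : forall i t w, (1 <= t <= T)%N ->
    grad h (mirrored p i t w) = grad h (decision p i t w) + step t *: u i t w ;
  run_project : forall i t w, (1 <= t <= T)%N ->
    is_argmin X (fun a => bregman h a (mirrored p i t w)) (projected p i t w) ;
  run_predict : forall i t w, (1 <= t <= T)%N ->
    predicted p i t w = B t *m projected p i t w ;
  run_consensus : forall i t w, (1 <= t <= T)%N ->
    decision p i t.+1 w
      = \sum_(j in in_neighbours E t i) A t i j *: predicted p j t w }.

Definition random_iterates {d} (p : iterates d) : Prop :=
  forall i t, [/\ random_vector (decision p i t),
                  random_vector (mirrored p i t),
                  random_vector (projected p i t) &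
                  random_vector (predicted p i t)].

Definition round_events {d} (p : iterates d)
    (g : 'I_n -> nat -> Omega -> 'cV[R]_d) (s : nat) : set (set Omega) :=
  \bigcup_(i : 'I_n)
    (events_of (decision p i s) `|` events_of (g i s)
     `|` events_of (mirrored p i s) `|` events_of (projected p i s)
     `|` events_of (predicted p i s)).

(* F_t; it is trivial for t = 0 since the initial decisions are deterministic. *)
Definition history {d m} (px : iterates d) (py : iterates m)
    (gx : 'I_n -> nat -> Omega -> 'cV[R]_d)
    (gy : 'I_n -> nat -> Omega -> 'cV[R]_m) (t : nat) : set (set Omega) :=
  <<s \bigcup_(s in [set s | (1 <= s <= t)%N])
        (round_events px gx s `|` round_events py gy s) >>.

Definition realized {d m d'}
    (G : 'I_n -> nat -> 'cV[R]_d -> 'cV[R]_m -> Omega -> 'cV[R]_d')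
    (px : iterates d) (py : iterates m) (i : 'I_n) (t : nat) (w : Omega) :=
  G i t (decision px i t w) (decision py i t w) w.

(* The conditional moments are prescribed at every fixed point (a, b) of
   X x Y and at the current decisions (x_{i,t}, y_{i,t}), which are determined
   by F_{t-1}.  The second clause does not follow from the first, whose
   exceptional null sets may depend on (a, b). *)
Definition stochastic_oracle {d m} (P : probability Omega R)
    (Nx : 'cV[R]_d -> R) (Ny : 'cV[R]_m -> R)
    (X : set 'cV[R]_d) (Y : set 'cV[R]_m)
    (f : 'I_n -> nat -> 'cV[R]_d -> 'cV[R]_m -> R)
    (Gx : 'I_n -> nat -> 'cV[R]_d -> 'cV[R]_m -> Omega -> 'cV[R]_d)
    (Gy : 'I_n -> nat -> 'cV[R]_d -> 'cV[R]_m -> Omega -> 'cV[R]_m)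
    (px : iterates d) (py : iterates m) (T : nat) (LX LY : R) : Prop :=
  let F := history px py (realized Gx px py) (realized Gy px py) in
  let gradx i t a b := grad (fun a' => f i t a' b) a in
  let grady i t a b := grad (fun b' => f i t a b') b in
  forall i t, (1 <= t <= T)%N ->
    (forall a b, X a -> Y b ->
       unbiased_bounded P Nx (F t.-1) (Gx i t a b)
         (fun=> gradx i t a b) LX /\
       unbiased_bounded P Ny (F t.-1) (Gy i t a b)
         (fun=> grady i t a b) LY) /\
    (unbiased_bounded P Nx (F t.-1) (realized Gx px py i t)
       (fun w => gradx i t (decision px i t w) (decision py i t w)) LX /\
     unbiased_bounded P Ny (F t.-1) (realized Gy px py i t)
       (fun w => grady i t (decision px i t w) (decision py i t w)) LY).

Definition total_payoff {d m} (f : 'I_n -> nat -> 'cV[R]_d -> 'cV[R]_m -> R)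
    (t : nat) (a : 'cV[R]_d) (b : 'cV[R]_m) : R := \sum_(i < n) f i t a b.

Definition esp_regret {d m} (P : probability Omega R)
    (f : 'I_n -> nat -> 'cV[R]_d -> 'cV[R]_m -> R)
    (xs : nat -> 'cV[R]_d) (ys : nat -> 'cV[R]_m)
    (px : iterates d) (py : iterates m) (T : nat) (j : 'I_n) : \bar R :=
  (`| 'E_P[fun w =>
        (\sum_(1 <= t < T.+1)
           total_payoff f t (decision px j t w) (decision py j t w)
         - \sum_(1 <= t < T.+1) total_payoff f t (xs t) (ys t))%R] |)%E.

End Algorithm.
Arguments iterates {R disp} Omega n d.

Definition average {R : realType} {n d : nat} (a : 'I_n -> 'cV[R]_d) :=
  n%:R^-1 *: \sum_(i < n) a i.

(* Main.v *)
Require Import Defs.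
From mathcomp Require Import ring lra zify measurable_realfun.

(* Write phi for the regret of agent j along a trajectory. Let (u_t, v_t) be the
   saddle point. Comparing f_t(u_t, v_t) with f_t(u_t, y_avg), convexity bounds phi by the
   linearised terms <grad_x f_i(x_i, y_i), x_i - u_t> plus (n + 2) times the consensus errors.
   - The linearised terms are controlled by the mirror step: Bregman divergences to u_t
     decrease up to the drift of u_t, and divided by alpha_t they telescope; replacing
     the gradient by the stochastic one costs nothing in mean, since x_i at time t is a
     combination of F_(t-1)-measurable vectors.
   - The consensus errors are driven by the products of the weight matrices. On zero-mean
     vectors these contract the sum of squares by 1 - zeta / (2 n^2) over every connected
     window: order the initial values, and charge the square of each gap to the first round
     at which an edge crosses the corresponding cut.
   Taking means only uses E ||g||_*^2 <= L^2. The lower bound on phi follows by exchanging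
   the two players and replacing f by - f. *)

Local Open Scope classical_set_scope.
Local Open Scope ring_scope.

(** * Contraction of the averaging matrices *)

(** The constants Gamma and sigma come from two conversions. Sums of squares contract by 1 - zeta /
    (2 n^2) per window, hence the deviations themselves by 1 - zeta / (4 n^2), whose square is
    slightly larger. Connectivity is given only on windows aligned at times k Q + 1, so up to two
    windows are lost, which is the 2 Q in the exponent of Gamma. Only the squared dual norm of a
    stochastic gradient has a controlled mean, and the regret is not assumed measurable. All
    estimates are therefore made pointwise on the sample space, with L ||g||_* replaced by
    (||g||_*^2 + L^2) / 2, and the mean is taken once, of an explicit integrable majorant. Nothing
    is lost, since each half has mean at most L^2 / 2. The consensus errors also need the payoffs to
    be Lipschitz, hence a bound L on the true gradients; it follows by Jensen from the oracle at
    fixed points. Telescoping the divergences divided by alpha_t relies on nonincreasing step sizes: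
    the increments of 1 / alpha_t are then nonnegative and add up to at most 1 / alpha_T. *)

Lemma weighted_variance (R : realType) (n : nat) (p x : 'I_n -> R) :
  \sum_j p j = 1 ->
  \sum_j p j * x j ^+ 2 - (\sum_j p j * x j) ^+ 2
  = 2^-1 * \sum_j \sum_l p j * p l * (x j - x l) ^+ 2.
Proof.
move=> p1.
have -> : \sum_j \sum_l p j * p l * (x j - x l) ^+ 2
  = \sum_j (p j * x j ^+ 2 * (\sum_l p l) + p j * (\sum_l p l * x l ^+ 2)
     - 2 * (p j * x j) * (\sum_l p l * x l)).
  apply: eq_bigr => j _; rewrite !mulr_sumr -!big_split -sumrB /=.
  by apply: eq_bigr => l _; ring.
rewrite sumrB big_split /= p1 -!mulr_suml p1 -mulr_sumr.
by field.
Qed.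

(** The selected steps are disjoint intervals inside [a, b]. Clipping [s] to [a, b] leaves them
    unchanged and makes every other step nonnegative, so the full clipped sum telescopes. *)
Lemma sum_cuts_le (R : realType) (m : nat) (s : nat -> R) (P : pred nat) (a b : R) :
  {homo s : i j / (i <= j)%N >-> i <= j} ->
  (forall k, (k < m)%N -> P k -> a <= s k /\ s k.+1 <= b) -> a <= b ->
  \sum_(0 <= k < m | P k) (s k.+1 - s k) <= b - a.
Proof.
move=> s_homo sP ab.
pose c x := Num.max a (Num.min b x).
have c_homo x y : x <= y -> c x <= c y.
  move=> xy; rewrite /c ge_max !le_max lexx /= le_min !ge_min lexx xy !orbT /=.
  by rewrite ?orbT.
have cab x : a <= c x <= b.
  by rewrite /c le_max lexx /= ge_max ab ge_min lexx.
have cE x : a <= x -> x <= b -> c x = x.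
  by move=> ax xb; rewrite /c (min_idPr xb) (max_idPr ax).
apply: (@le_trans _ _ (\sum_(0 <= k < m) (c (s k.+1) - c (s k)))).
  rewrite big_mkcond /= big_nat_cond [leRHS]big_nat_cond.
  apply: ler_sum => k; rewrite andbT => /andP[_ km].
  have ss : s k <= s k.+1 by exact/s_homo.
  case: ifPn => Pk; last by rewrite subr_ge0 c_homo.
  have [ak kb] := sP k km Pk.
  by rewrite !cE // (le_trans ak, le_trans _ kb).
rewrite telescope_sumr //.
by have /andP[_ ?] := cab (s m); have /andP[? _] := cab (s 0%N); rewrite lerB.
Qed.

Lemma sum_sqr_le_sqr_sum (R : realType) (I : Type) (r : seq I) (P : pred I) (F : I -> R) :
  (forall i, P i -> 0 <= F i) ->
  \sum_(i <- r | P i) F i ^+ 2 <= (\sum_(i <- r | P i) F i) ^+ 2.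
Proof.
move=> F0.
elim: r => [|i r IH]; first by rewrite !big_nil expr0n.
rewrite !big_cons; case: ifPn => // Pi.
have := F0 _ Pi; have : 0 <= \sum_(j <- r | P j) F j by exact: sumr_ge0.
nra.
Qed.

Lemma sqr_sum_le (R : realType) (m : nat) (F : nat -> R) :
  (\sum_(0 <= k < m) F k) ^+ 2 <= m%:R * \sum_(0 <= k < m) F k ^+ 2.
Proof.
case: m => [|m]; first by rewrite !big_geq // expr0n /= mul0r.
elim: m => [|m]; first by rewrite !big_nat1 mul1r.
move: m.+1 (ltn0Sn m) => {}m m0 IH; rewrite !big_nat_recr //=.
set S := \sum_(0 <= k < m) F k in IH *; set V := \sum_(0 <= k < m) F k ^+ 2 in IH *.
have V0 : 0 <= V by apply: sumr_ge0 => k _; exact: sqr_ge0.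
have m_gt0 : 0 < m%:R :> R by rewrite ltr0n.
have -> : m.+1%:R = m%:R + 1 :> R by rewrite natr1.
(* AM-GM: [2 S F m <= S^2 / m + m (F m)^2] *)
have Sm : S ^+ 2 / m%:R <= V by rewrite ler_pdivrMr // mulrC.
have : 0 <= (S / m%:R - F m) ^+ 2 * m%:R by rewrite mulr_ge0 ?sqr_ge0 // ltW.
have -> : (S / m%:R - F m) ^+ 2 * m%:R = S ^+ 2 / m%:R - 2 * S * F m + m%:R * F m ^+ 2.
  by field; rewrite gt_eqF.
nra.
Qed.

(** The larger mass is at least 1/2 and the other one at least [z]. *)
Lemma split_mass_ge (R : realFieldType) (p q z : R) :
  p + q = 1 -> z <= p -> z <= q -> 0 <= z -> z / 2 <= p * q.
Proof. move=> pq zp zq z0; have [h|h] := lerP p q; nra. Qed.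

Section WindowContraction.
Context {R : realType} {n Q : nat}.
Variables (M : nat -> 'I_n -> 'I_n -> R) (z : R).
Hypothesis z0 : 0 <= z.
Hypothesis M_ge0 : forall s i j, 0 <= M s i j.
Hypothesis M_row : forall s i, \sum_j M s i j = 1.
Hypothesis M_col : forall s j, \sum_i M s i j = 1.
Hypothesis M_diag : forall s i, z <= M s i i.
Hypothesis M_pos : forall s i j, M s i j = 0 \/ z <= M s i j.
Hypothesis M_cut : forall S : pred 'I_n, (exists i, S i) -> (exists i, ~~ S i) ->
  exists2 s, (s < Q)%N & exists i j, S i != S j /\ M s i j != 0.
Variable x : nat -> 'I_n -> R.
Hypothesis xS : forall s i, x s.+1 i = \sum_j M s i j * x s j.

(** Total variance of the values under the rows of [M s], written over pairs so that the pairs lying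
    across a cut can be singled out. *)
Definition spread_loss s : R :=
  2^-1 * \sum_i \sum_j \sum_l M s i j * M s i l * (x s j - x s l) ^+ 2.

Lemma sum_sqr_step s :
  \sum_i x s.+1 i ^+ 2 = \sum_i x s i ^+ 2 - spread_loss s.
Proof.
have -> : spread_loss s = \sum_i (\sum_j M s i j * x s j ^+ 2 - x s.+1 i ^+ 2).
  rewrite /spread_loss mulr_sumr; apply: eq_bigr => i _.
  by rewrite xS weighted_variance.
rewrite sumrB exchange_big /=.
under [X in _ - (X - _)]eq_bigr do rewrite -mulr_suml M_col mul1r.
by rewrite opprB addrC subrK.
Qed.

Lemma spread_loss_ge0 s : 0 <= spread_loss s.
Proof.
apply: mulr_ge0; first by rewrite invr_ge0.
apply: sumr_ge0 => i _; apply: sumr_ge0 => j _.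
apply: sumr_ge0 => l _; apply: mulr_ge0; last exact: sqr_ge0.
exact: mulr_ge0.
Qed.

Section Sorted.
(* [v] lists the initial values in increasing order; cut [k] separates the agents
   whose initial value is at least [v k.+1] from those for which it is at most [v k]. *)
Variable v : nat -> R.
Hypothesis v_homo : {homo v : i j / (i <= j)%N >-> i <= j}.
Hypothesis v_surj : forall i, exists2 k, (k < n)%N & x 0 i = v k.
Hypothesis v_val : forall k, (k < n)%N -> exists i, x 0 i = v k.

Let gap k := v k.+1 - v k.
Let S k : pred 'I_n := fun i => v k.+1 <= x 0 i.

Let crossing k s := [exists i, exists j, (S k i != S k j) && (M s i j != 0)].

Let cut_lo k i : ~~ S k i -> x 0 i <= v k.
Proof.
rewrite /S; have [l _ ->] := v_surj i; rewrite -ltNge => vlk.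
apply: v_homo; rewrite leqNgt; apply: contraTN vlk => kl.
by rewrite -leNgt; exact: v_homo.
Qed.

(** The gap must be positive: for a zero gap [S k] may hold of every agent, and there is no cut to
    cross. *)
Let crossing_exists k : (k.+1 < n)%N -> 0 < gap k -> exists2 s, (s < Q)%N & crossing k s.
Proof.
move=> kn g0; have [||s sQ [i [j [Sij Mij]]]] := @M_cut (S k).
- by have [i xi] := v_val kn; exists i; rewrite /S xi.
- have [i xi] := v_val (ltnW kn); exists i.
  by rewrite /S xi -ltNge -subr_gt0.
- by exists s => //; apply/existsP; exists i; apply/existsP; exists j; apply/andP.
Qed.

Let first_crossing k s := crossing k s && [forall r : 'I_s, ~~ crossing k r].

Let first_crossing_exists k : (k.+1 < n)%N -> 0 < gap k ->
  exists s : 'I_Q, first_crossing k s.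
Proof.
move=> kn g0; have [s0 s0Q c0] := crossing_exists kn g0.
have ex : exists s, crossing k s by exists s0.
case: (ex_minnP ex) => s cs smin.
have sQ : (s < Q)%N by exact: leq_ltn_trans (smin _ c0) s0Q.
exists (Ordinal sQ); rewrite /first_crossing /= cs /=.
apply/forallP => r; apply/negP => /smin; rewrite leqNgt.
by rewrite ltn_ord.
Qed.

(** As long as no weight joins the two sides, each side averages only its own values, so the gap
    between them stays open. *)
Let cut_preserved k s : (forall r, (r < s)%N -> ~~ crossing k r) ->
  forall i, if S k i then v k.+1 <= x s i else x s i <= v k.
Proof.
elim: s => [_ i|s IH nc i]; first by case: ifPn => // /cut_lo.
have {}IH j : if S k j then v k.+1 <= x s j else x s j <= v k.
  by apply: IH => r rs; apply: nc; rewrite ltnS ltnW.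
have M0 j : S k i != S k j -> M s i j = 0.
  move=> Sij; apply/eqP; apply: contraNT (nc s (ltnSn s)) => Mij.
  by apply/existsP; exists i; apply/existsP; exists j; apply/andP.
rewrite xS; case: ifPn => Si.
- rewrite -[leLHS]mul1r -(M_row s i) mulr_suml; apply: ler_sum => j _.
  have := IH j; case: ifPn => Sj h; first by rewrite ler_wpM2l.
  by rewrite M0 ?mul0r // Si (negPf Sj).
- rewrite -[leRHS]mul1r -(M_row s i) mulr_suml; apply: ler_sum => j _.
  have := IH j; case: ifPn => Sj h; last by rewrite ler_wpM2l.
  by rewrite M0 ?mul0r // (negPf Si) Sj.
Qed.

Let sep k j l := S k j != S k l.

(** The cuts first crossed at round [s] are still open there. Those separating [j] from [l] give
    disjoint gaps between the two current values, and the sum of their squares is at most the square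
    of their sum. *)
Let sqr_dist_ge s j l :
  \sum_(0 <= k < n.-1 | first_crossing k s && (0 < gap k)) (sep k j l)%:R * gap k ^+ 2
  <= (x s j - x s l) ^+ 2.
Proof.
wlog jl : j l / x 0 l <= x 0 j.
  move=> H; have [/H //|/ltW/H] := lerP (x 0 l) (x 0 j).
  rewrite -[X in _ -> _ <= X]sqrrN opprB; apply: le_trans.
  by apply: ler_sum => k _; rewrite /sep eq_sym.
pose PK k := [&& first_crossing k s, 0 < gap k & sep k j l].
have PKP k : PK k -> x s l <= v k /\ v k.+1 <= x s j.
  move=> /and3P[/andP[_ /forallP fc] _ sp].
  have H := @cut_preserved k s (fun r rs => fc (Ordinal rs)).
  have := H j; have := H l; move: sp; rewrite /sep.
  case: ifPn => Sl; case: ifPn => Sj // _.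
  by move: Sj; rewrite /S (le_trans Sl).
have -> : \sum_(0 <= k < n.-1 | first_crossing k s && (0 < gap k)) (sep k j l)%:R * gap k ^+ 2
   = \sum_(0 <= k < n.-1 | PK k) gap k ^+ 2.
  rewrite big_mkcond [RHS]big_mkcond; apply: eq_bigr => k _ /=.
  rewrite /PK; case: (first_crossing k s); case: (0 < gap k); case: (sep k j l) => //=;
  by rewrite ?mul1r ?mul0r.
have [hP|] := boolP (has PK (index_iota 0 n.-1)); last first.
  move=> /hasPn nP; rewrite big_seq_cond big1 ?sqr_ge0 //.
  by move=> k /andP[/nP/negPf->].
have gap0 k : 0 <= gap k by rewrite subr_ge0; exact: v_homo.
(* The initial order of [l] and [j] need not persist in general; an open cut that separates them
   preserves it. *)
have xlj : x s l <= x s j.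
  move: hP => /hasP[k _ /PKP[h1 h2]].
  by apply: le_trans (le_trans h1 _) h2; exact: v_homo.
apply: (le_trans (sum_sqr_le_sqr_sum _ _)) => //.
rewrite lerXn2r ?nnegrE ?sumr_ge0 ?subr_ge0 //.
by apply: sum_cuts_le => // k _ /PKP.
Qed.

(** The agent [i] hearing across the cut puts weight at least [z] on both sides: on its own through
    the diagonal, on the other through the crossing entry. With masses p and q, the ordered
    separated pairs weigh 2 p q >= z. *)
Let sep_mass k s : crossing k s ->
  z <= \sum_i \sum_j \sum_l M s i j * M s i l * (sep k j l)%:R.
Proof.
move=> /existsP[i /existsP[j /andP[Sij Mij]]].
have zM : z <= M s i j by have [M0|//] := M_pos s i j; rewrite M0 eqxx in Mij.
have mass_ge0 i' : 0 <= \sum_j \sum_l M s i' j * M s i' l * (sep k j l)%:R.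
  apply: sumr_ge0 => j' _; apply: sumr_ge0 => l _.
  by apply: mulr_ge0; [exact: mulr_ge0|rewrite ler0n].
rewrite (bigD1 i) //= -[leLHS]addr0 lerD ?sumr_ge0 //.
pose p := \sum_j M s i j * (S k j)%:R; pose q := \sum_j M s i j * (~~ S k j)%:R.
have -> : \sum_j \sum_l M s i j * M s i l * (sep k j l)%:R = 2 * (p * q).
  have -> : 2 * (p * q) = p * q + q * p by ring.
  rewrite /p /q !mulr_suml -big_split /=; apply: eq_bigr => j' _.
  rewrite !mulr_sumr -big_split /=; apply: eq_bigr => l _.
  by rewrite /sep; case: (S k j'); case: (S k l); rewrite /= ?mulr1n ?mulr0n; ring.
have pq : p + q = 1.
  rewrite -(M_row s i) /p /q -big_split /=; apply: eq_bigr => l _.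
  by case: (S k l); rewrite /= ?mulr1n ?mulr0n; ring.
have le_mass (T : pred 'I_n) j' : T j' -> M s i j' <= \sum_j M s i j * (T j)%:R.
  move=> Tj; rewrite (bigD1 j') //= Tj mulr1 lerDl.
  by apply: sumr_ge0 => l _; rewrite mulr_ge0.
have [zp zq] : z <= p /\ z <= q.
  move: Sij; case: (boolP (S k i)) => Si; case: (boolP (S k j)) => Sj // _; split.
  - exact: le_trans (M_diag s i) (le_mass _ _ Si).
  - exact: le_trans zM (le_mass (fun l => ~~ S k l) _ Sj).
  - exact: le_trans zM (le_mass _ _ Sj).
  - exact: le_trans (M_diag s i) (le_mass (fun l => ~~ S k l) _ Si).
by have := split_mass_ge pq zp zq z0; lra.
Qed.

Let spread_loss_ge s :
  z / 2 * \sum_(0 <= k < n.-1 | first_crossing k s && (0 < gap k)) gap k ^+ 2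
  <= spread_loss s.
Proof.
have -> : z / 2 = 2^-1 * z by rewrite mulrC.
rewrite /spread_loss -mulrA ler_wpM2l ?invr_ge0 //.
apply: (@le_trans _ _ (\sum_i \sum_j \sum_l M s i j * M s i l *
  \sum_(0 <= k < n.-1 | first_crossing k s && (0 < gap k))
    (sep k j l)%:R * gap k ^+ 2)); last first.
  do 3![apply: ler_sum => ? _]; rewrite ler_wpM2l ?mulr_ge0 //; exact: sqr_dist_ge.
have -> : \sum_i \sum_j \sum_l M s i j * M s i l *
    \sum_(0 <= k < n.-1 | first_crossing k s && (0 < gap k)) (sep k j l)%:R * gap k ^+ 2
  = \sum_(0 <= k < n.-1 | first_crossing k s && (0 < gap k))
     gap k ^+ 2 * \sum_i \sum_j \sum_l M s i j * M s i l * (sep k j l)%:R.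
  under [RHS]eq_bigr do rewrite mulr_sumr.
  rewrite [RHS]exchange_big; apply: eq_bigr => i _ /=.
  under [RHS]eq_bigr do rewrite mulr_sumr.
  rewrite [RHS]exchange_big; apply: eq_bigr => j _ /=.
  under [RHS]eq_bigr do rewrite mulr_sumr.
  rewrite [RHS]exchange_big; apply: eq_bigr => l _ /=.
  by rewrite mulr_sumr; apply: eq_bigr => k _; ring.
rewrite mulr_sumr; apply: ler_sum => k /andP[/andP[ck _] _].
by rewrite mulrC ler_wpM2l ?sqr_ge0 // sep_mass.
Qed.

Let total_loss_ge :
  z / 2 * \sum_(0 <= k < n.-1) gap k ^+ 2 <= \sum_(s < Q) spread_loss s.
Proof.
apply: (@le_trans _ _ (\sum_(s < Q) z / 2 *
   \sum_(0 <= k < n.-1 | first_crossing k s && (0 < gap k)) gap k ^+ 2)); last first.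
  by apply: ler_sum => s _; exact: spread_loss_ge.
rewrite -mulr_sumr ler_wpM2l ?divr_ge0 //.
under [leRHS]eq_bigr do rewrite big_mkcond /=.
rewrite exchange_big /= big_nat_cond [leRHS]big_nat_cond.
apply: ler_sum => k /andP[/andP[_ kn] _].
have gap0 : 0 <= gap k by rewrite subr_ge0; exact: v_homo.
have term_ge0 (s : 'I_Q) :
    0 <= if first_crossing k s && (0 < gap k) then gap k ^+ 2 else 0.
  by case: ifP => // _; exact: sqr_ge0.
have [g0|] := ltrP 0 (gap k).
  have [|s fc] := @first_crossing_exists k _ g0; first by rewrite -ltn_predRL.
  by rewrite (bigD1 s) //= fc /= lerDl sumr_ge0 // => i _; rewrite -[X in _ && X]g0.
move=> g0; have -> : gap k = 0 by apply/le_anti; rewrite g0.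
by rewrite expr0n /= sumr_ge0 // => s _; case: ifP.
Qed.

(** Zero mean places 0 between the extreme values, so each square is at most the squared range,
    which Cauchy-Schwarz bounds by n times the sum of squared gaps. Summing over the n agents gives
    the second factor n. *)
Let sum_sqr_le_gaps : \sum_i x 0 i = 0 ->
  \sum_i x 0 i ^+ 2 <= n%:R ^+ 2 * \sum_(0 <= k < n.-1) gap k ^+ 2.
Proof.
move=> x00; have [n0|n_gt0] := posnP n.
  by rewrite big1 ?n0 ?expr0n ?mul0r // => i; have := ltn_ord i; rewrite {2}n0.
set G := \sum_(0 <= k < n.-1) gap k ^+ 2.
have G_gaps : (v n.-1 - v 0) ^+ 2 <= n%:R * G.
  rewrite -telescope_sumr //; apply: le_trans (sqr_sum_le _ _) _.
  rewrite ler_wpM2r ?ler_nat ?leq_pred //.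
  by apply: sumr_ge0 => k _; exact: sqr_ge0.
have xv i : v 0 <= x 0 i <= v n.-1.
  have [k kn ->] := v_surj i; apply/andP; split; apply: v_homo => //.
  by rewrite -ltnS prednK.
have [v0 vn] : v 0 <= 0 /\ 0 <= v n.-1.
  have n_gt0' : 0 < n%:R :> R by rewrite ltr0n.
  have cst (c : R) : \sum_(i < n) c = c * n%:R.
    by rewrite sumr_const card_ord mulr_natr.
  split.
  - rewrite -(pmulr_lle0 _ n_gt0') -cst -[leRHS]x00.
    by apply: ler_sum => i _; have /andP[] := xv i.
  - rewrite -(pmulr_lge0 _ n_gt0') -cst -[leLHS]x00.
    by apply: ler_sum => i _; have /andP[] := xv i.
rewrite expr2 -mulrA; apply: (@le_trans _ _ (\sum_(i < n) n%:R * G)); last first.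
  by rewrite sumr_const card_ord -[leLHS]mulr_natl.
apply: ler_sum => i _; apply: le_trans G_gaps.
have /andP[] := xv i; nra.
Qed.

Lemma window_contraction_sorted : \sum_i x 0 i = 0 ->
  \sum_i x Q i ^+ 2 <= (1 - z / (2 * n%:R ^+ 2)) * \sum_i x 0 i ^+ 2.
Proof.
move=> x00.
have -> : \sum_i x Q i ^+ 2 = \sum_i x 0 i ^+ 2 - \sum_(s < Q) spread_loss s.
  elim: Q => [|q IH]; first by rewrite big_ord0 subr0.
  by rewrite sum_sqr_step IH big_ord_recr /= opprD addrA.
rewrite mulrBl mul1r lerD2l lerN2; apply: le_trans total_loss_ge.
have := sum_sqr_le_gaps x00.
have [n0|n_gt0] := posnP n.
  have -> : n%:R = 0 :> R by rewrite n0.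
  by move=> _; rewrite expr0n /= mulr0 invr0 mulr0 mul0r mulr_ge0 ?divr_ge0 //
     sumr_ge0 // => k _; exact: sqr_ge0.
set V := \sum_i _; set G := \sum_(0 <= k < _) _ => VG.
have n2 : 0 < n%:R ^+ 2 :> R by rewrite exprn_gt0 // ltr0n.
have -> : z / (2 * n%:R ^+ 2) * V = z / 2 * (V / n%:R ^+ 2).
  by field; rewrite pnatr_eq0 -lt0n.
by rewrite ler_wpM2l ?divr_ge0 // ler_pdivrMr // mulrC.
Qed.

End Sorted.

Lemma window_contraction : \sum_i x 0 i = 0 ->
  \sum_i x Q i ^+ 2 <= (1 - z / (2 * n%:R ^+ 2)) * \sum_i x 0 i ^+ 2.
Proof.
pose vals := sort <=%O [seq x 0 i | i <- enum 'I_n].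
have size_vals : size vals = n by rewrite size_sort size_map size_enum_ord.
have mem_vals a : (a \in vals) = (a \in [seq x 0 i | i <- enum 'I_n]).
  by rewrite mem_sort.
(* Truncating the index continues the sorted list by its last value; the default 0 of [nth] could
   break monotonicity. *)
apply: (@window_contraction_sorted (fun k => nth 0 vals (minn k n.-1))).
- move=> a b ab; have [n0|n_gt0] := posnP n.
    by rewrite !nth_default // size_vals n0.
  apply: (sorted_leq_nth le_trans lexx) => //; rewrite ?inE ?size_vals.
  + by apply: sort_sorted; exact: le_total.
  + by rewrite -[X in (_ < X)%N](prednK n_gt0) ltnS geq_minr.
  + by rewrite -[X in (_ < X)%N](prednK n_gt0) ltnS geq_minr.
  + by rewrite leq_min geq_minr geq_min ab.
- move=> i; have xi : x 0 i \in vals.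
    by rewrite mem_vals; apply: map_f; rewrite mem_enum.
  have iv : (index (x 0 i) vals < n)%N by rewrite -size_vals index_mem.
  exists (index (x 0 i) vals) => //.
  have -> : minn (index (x 0 i) vals) n.-1 = index (x 0 i) vals.
    by apply/minn_idPl; rewrite -ltnS prednK // (leq_trans _ iv).
  by rewrite nth_index.
- move=> k kn; have -> : minn k n.-1 = k.
    by apply/minn_idPl; rewrite -ltnS prednK // (leq_trans _ kn).
  have : nth 0 vals k \in vals by rewrite mem_nth // size_vals.
  by rewrite mem_vals => /mapP[i _ ->]; exists i.
Qed.

Lemma sum_sqr_nonincr s : \sum_i x s.+1 i ^+ 2 <= \sum_i x s i ^+ 2.
Proof. by rewrite sum_sqr_step gerBl spread_loss_ge0. Qed.

End WindowContraction.

(** * Geometric decay of the products of the weight matrices *)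

Fixpoint transition {R : realType} {n : nat} (A : nat -> 'M[R]_n) (s k : nat) : 'M[R]_n :=
  if k is k'.+1 then A (s + k')%N *m transition A s k' else 1%:M.

Section Transition.
Context {R : realType} {n Q : nat}.
Variables (E : nat -> rel 'I_n) (A : nat -> 'M[R]_n) (zeta : R).
Hypothesis zeta0 : 0 < zeta.
Hypothesis zeta1 : zeta < 1.
Hypothesis netA : weighted_network E A zeta.
Hypothesis Q0 : (0 < Q)%N.
Hypothesis connE : jointly_connected E Q.

Lemma connect_crosses (T : finType) (e : rel T) (S : pred T) a b :
  connect e a b -> S a -> ~~ S b -> exists u v, [/\ e u v, S u & ~~ S v].
Proof.
move=> /connectP[p]; elim: p a => [|c p IH] a /=; first by move=> _ -> ->.
move=> /andP[eac pc] bE Sa Sb.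
have [Sc|Sc] := boolP (S c); first exact: IH pc bE Sc Sb.
by exists a, c.
Qed.

Lemma weight_ge0 t i j : (1 <= t)%N -> 0 <= A t i j.
Proof. by move=> /netA[[]]. Qed.

Lemma weight_row t i : (1 <= t)%N -> \sum_j A t i j = 1.
Proof. by move=> /netA[[]]. Qed.

Lemma weight_col t j : (1 <= t)%N -> \sum_i A t i j = 1.
Proof. by move=> /netA[[]]. Qed.

Lemma transition_col s k j : (1 <= s)%N -> \sum_i transition A s k i j = 1.
Proof.
move=> s1; elim: k => [|k IH] /=.
  rewrite (bigD1 j) //= mxE eqxx big1 ?addr0 // => i ij.
  by rewrite mxE (negPf ij).
under eq_bigr do rewrite mxE.
rewrite exchange_big /= -[RHS]IH; apply: eq_bigr => l _.
by rewrite -mulr_suml weight_col ?mul1r // (leq_trans s1) // leq_addr.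
Qed.

Section Column.
Variables (s : nat) (j : 'I_n).
Hypothesis s1 : (1 <= s)%N.

(** Deviation of column [j] from its limit. Unit column sums give it zero mean, and unit row sums
    make it evolve by the same averaging, so the window contraction applies. *)
Let y r (i : 'I_n) := transition A s r i j - n%:R^-1.

Let n_gt0 : (0 < n)%N. Proof. exact: leq_ltn_trans (ltn_ord j). Qed.

Let y_sum r : \sum_i y r i = 0.
Proof.
rewrite sumrB transition_col // sumr_const card_ord -[n%:R^-1 *+ n]mulr_natl divff ?subrr //.
by rewrite pnatr_eq0 -lt0n.
Qed.

Let yS r i : y r.+1 i = \sum_l A (s + r)%N i l * y r l.
Proof.
rewrite /y /= mxE; under [RHS]eq_bigr do rewrite mulrBr.
by rewrite sumrB -mulr_suml weight_row ?mul1r // (leq_trans s1) // leq_addr.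
Qed.

Let V r := \sum_i y r i ^+ 2.

Let V_step r : V r.+1 <= V r.
Proof.
have := @sum_sqr_nonincr R n (fun t => A (s + t)%N) _ _ _ y yS r; apply.
- by move=> t i l; apply: weight_ge0; rewrite (leq_trans s1) // leq_addr.
- by move=> t i; apply: weight_row; rewrite (leq_trans s1) // leq_addr.
- by move=> t i; apply: weight_col; rewrite (leq_trans s1) // leq_addr.
Qed.

Let V_homo r r' : (r <= r')%N -> V r' <= V r.
Proof.
move=> /subnKC <-; elim: (r' - r)%N => [|k IH]; first by rewrite addn0.
by rewrite addnS (le_trans (V_step _)).
Qed.

(** The condition on [r] aligns the window with one for which joint connectivity is assumed. *)
Let V_window K r : (s + r = (K * Q).+1)%N ->
  V (r + Q) <= (1 - zeta / (2 * n%:R ^+ 2)) * V r.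
Proof.
move=> srK; have t1 t : (1 <= s + (r + t))%N by rewrite (leq_trans s1) // leq_addr.
have := @window_contraction R n Q (fun t => A (s + (r + t))%N) zeta (ltW zeta0)
  _ _ _ _ _ _ (fun t => y (r + t)).
rewrite addn0; apply => //.
- by move=> t i l; apply: weight_ge0.
- by move=> t i; apply: weight_row.
- by move=> t i; apply: weight_col.
- move=> t i; apply/ltW; have [_ /(_ i i)[+ _]] := netA (t1 t); apply.
  by rewrite inE eqxx.
- move=> t i l; have [_ /(_ i l)[h1 h2]] := netA (t1 t).
  have [il|il] := boolP (l \in in_neighbours E (s + (r + t)) i).
    by right; exact/ltW/h1.
  by left; exact: h2.
- move=> S [a Sa] [b Sb].
  have [u [v [/existsP[t Euv] Su Sv]]] := connect_crosses (connE K a b) Sa Sb.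
  (* An edge from [u] to [v] means that [v] hears [u]: the nonzero entry is in row [v] and column
     [u]. *)
  exists t => //; exists v, u; rewrite Su (negPf Sv); split=> //.
  rewrite addnA srK addSn.
  have [_ /(_ v u)[h _]] := @netA (K * Q + t).+1 isT.
  by apply/lt0r_neq0/(lt_trans zeta0)/h; rewrite inE Euv orbT.
- by move=> t i; rewrite addnS yS.
Qed.

(** Rate per window for single entries, chosen so that its square is at least the factor 1 - zeta /
    (2 n^2) of the sums of squares. *)
Let decay : R := 1 - zeta / (4 * n%:R ^+ 2).

Let V_windows K r q : (s + r = (K * Q).+1)%N -> V (r + q * Q) <= decay ^+ (2 * q) * V r.
Proof.
have n2 : 1 <= n%:R ^+ 2 :> R by rewrite expr_ge1 // ler1n.
have contr : 1 - zeta / (2 * n%:R ^+ 2) <= decay ^+ 2.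
  have -> : decay ^+ 2 = 1 - zeta / (2 * n%:R ^+ 2) + (zeta / (4 * n%:R ^+ 2)) ^+ 2.
    by rewrite /decay; field; rewrite pnatr_eq0 -lt0n.
  by rewrite lerDl sqr_ge0.
move=> srK; elim: q => [|q IH]; first by rewrite mul0n addn0 muln0 mul1r.
rewrite mulSnr addnA.
apply: le_trans (@V_window (K + q) _ _) _.
  by rewrite addnA srK mulnDl.
have V0 r' : 0 <= V r' by apply: sumr_ge0 => i _; exact: sqr_ge0.
rewrite mulnS exprD -mulrA; apply: ler_pM => //.
rewrite subr_ge0 ler_pdivrMr ?mul1r; first by move: zeta1 n2; set N := n%:R ^+ 2; lra.
by rewrite mulr_gt0 // (lt_le_trans ltr01).
Qed.

Lemma decay_gt0 : 0 < decay.
Proof.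
have n2 : 1 <= n%:R ^+ 2 :> R by rewrite expr_ge1 // ler1n.
rewrite subr_gt0 ltr_pdivrMr ?mul1r; first by move: zeta1 n2; set N := n%:R ^+ 2; lra.
by rewrite mulr_gt0 // (lt_le_trans ltr01).
Qed.

Lemma decay_lt1 : decay < 1.
Proof.
rewrite gtrBl divr_gt0 // mulr_gt0 // exprn_gt0 // ltr0n //.
Qed.

Let V0_le1 : V 0 <= 1.
Proof.
have n_neq0 : n%:R != 0 :> R by rewrite pnatr_eq0 -lt0n.
have -> : V 0 = 1 - n%:R^-1.
  rewrite /V (bigD1 j) //= /y /= mxE eqxx.
  rewrite (eq_bigr (fun=> n%:R^-2)) => [|i ij]; last first.
    by rewrite mxE (negPf ij) sub0r sqrrN exprVn.
  rewrite sumr_const cardC1 card_ord -[_^-1 *+ n.-1]mulr_natl -subn1 natrB //.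
  by rewrite mulr1n; field.
by rewrite gerBl invr_ge0.
Qed.

(** Here [q] counts the full aligned windows among the [k] rounds. Fewer than [Q] rounds are lost
    before the first of them and fewer than [Q] after the last, which gives 2 Q. *)
Lemma transition_window_bound k : exists2 q,
  (k <= q * Q + 2 * Q)%N & forall i, `|transition A s k i j - n%:R^-1| <= decay ^+ q.
Proof.
(* [K] is (s - 1) / Q rounded up, the first window starting no earlier than [s], and [r] is the wait
   until it starts. *)
pose K := ((s.-1 + Q.-1) %/ Q)%N; pose r := ((K * Q).+1 - s)%N.
have dK := divn_eq (s.-1 + Q.-1) Q; have mK := ltn_pmod (s.-1 + Q.-1) Q0.
have srK : (s + r = (K * Q).+1)%N by rewrite /r /K; lia.
have rQ : (r < Q)%N by rewrite /r /K; lia.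
pose q := ((k - r) %/ Q)%N.
have dq := divn_eq (k - r) Q; have mq := ltn_pmod (k - r) Q0.
have sqr_le i c : 0 <= c -> V k <= c ^+ 2 -> `|y k i| <= c.
  move=> c0 Vc; rewrite -(ler_pXn2r (n:=2)) ?nnegrE // real_normK ?num_real //.
  apply: le_trans Vc; rewrite /V (bigD1 i) //= lerDl sumr_ge0 // => l _; exact: sqr_ge0.
exists q => [|i]; first by rewrite /q; lia.
apply: sqr_le; first by rewrite exprn_ge0 // ltW // decay_gt0.
have [kr|kr] := leqP k r.
  have -> : q = 0%N by rewrite /q (eqP kr) div0n.
  by rewrite expr0 expr1n (le_trans (V_homo (leq0n k))).
apply: (@le_trans _ _ (V (r + q * Q))); first by apply: V_homo; rewrite /q; lia.
apply: le_trans (V_windows _ srK) _.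
rewrite mulnC exprM -[leRHS]mulr1 ler_wpM2l ?sqr_ge0 //.
exact: le_trans (V_homo (leq0n r)) V0_le1.
Qed.

(** The exponents on the right add up to (k - 2 Q) / Q, which is at most the number of full windows,
    and [decay] is below 1. *)
Lemma transition_bound k i : (1 <= k)%N ->
  `|transition A s k i j - n%:R^-1|
  <= decay `^ ((1 - 2 * Q%:R) / Q%:R) * (decay `^ (1 / Q%:R)) ^+ k.-1.
Proof.
move=> k1; have [q kq /(_ i) h] := transition_window_bound k.
apply: le_trans h _.
rewrite -(powR_mulrn _ (powR_ge0 _ _)) -powRrM -powRD; last by rewrite (gt_eqF decay_gt0) implybT.
rewrite -(powR_mulrn _ (ltW decay_gt0)).
apply: ger_powR; first by rewrite decay_gt0 ltW ?decay_lt1.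
have Q_gt0 : 0 < Q%:R :> R by rewrite ltr0n.
have -> : (1 - 2 * Q%:R) / Q%:R + 1 / Q%:R * k.-1%:R = (k%:R - 2 * Q%:R) / Q%:R :> R.
  rewrite -[in RHS](prednK k1) -natr1; field; exact: lt0r_neq0.
by rewrite ler_pdivrMr // lerBlDr -!natrM -natrD ler_nat.
Qed.
End Column.
End Transition.

(** * Norms and convex sets in finite dimension *)

Section Dot.
Context {R : realType} {d : nat}.
Implicit Types a b c : 'cV[R]_d.

Lemma dotvDl a b c : dotv (a + b) c = dotv a c + dotv b c.
Proof. by rewrite -big_split; apply: eq_bigr => k _; rewrite mxE mulrDl. Qed.

Lemma dotvDr a b c : dotv c (a + b) = dotv c a + dotv c b.
Proof. by rewrite -big_split; apply: eq_bigr => k _; rewrite mxE mulrDr. Qed.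

Lemma dotvZl (s : R) a c : dotv (s *: a) c = s * dotv a c.
Proof. by rewrite mulr_sumr; apply: eq_bigr => k _; rewrite mxE mulrA. Qed.

Lemma dotvZr (s : R) a c : dotv c (s *: a) = s * dotv c a.
Proof. by rewrite mulr_sumr; apply: eq_bigr => k _; rewrite mxE mulrCA. Qed.

Lemma dotvNl a c : dotv (- a) c = - dotv a c.
Proof. by rewrite -scaleN1r dotvZl mulN1r. Qed.

Lemma dotvNr a c : dotv c (- a) = - dotv c a.
Proof. by rewrite -scaleN1r dotvZr mulN1r. Qed.

Lemma dotvBl a b c : dotv (a - b) c = dotv a c - dotv b c.
Proof. by rewrite dotvDl dotvNl. Qed.

Lemma dotvBr a b c : dotv c (a - b) = dotv c a - dotv c b.
Proof. by rewrite dotvDr dotvNr. Qed.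

End Dot.

Section Norm.
Context {R : realType} {d : nat}.
Variable N : 'cV[R]_d -> R.
Hypothesis normN : is_norm N.
Implicit Types a b g : 'cV[R]_d.

Lemma norm0 : N 0 = 0.
Proof. by rewrite -(scale0r 0) (normZ normN) normr0 mul0r. Qed.

Lemma norm_opp a : N (- a) = N a.
Proof. by rewrite -scaleN1r (normZ normN) normrN1 mul1r. Qed.

Lemma norm_ge0 a : 0 <= N a.
Proof.
have := normD normN a (- a); rewrite subrr norm0 norm_opp; lra.
Qed.

Lemma norm_sub a b : N (a - b) = N (b - a).
Proof. by rewrite -norm_opp opprB. Qed.

Lemma norm_sum (I : Type) (r : seq I) (P : pred I) (F : I -> 'cV[R]_d) :
  N (\sum_(i <- r | P i) F i) <= \sum_(i <- r | P i) N (F i).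
Proof.
elim/big_ind2 : _ => //; first by rewrite norm0.
by move=> a x b y ax by_; rewrite (le_trans (normD normN _ _)) // lerD.
Qed.

Lemma norm_coord_le a : N a <= \sum_k `|a k 0| * N (delta_mx k 0).
Proof.
have {1}-> : a = \sum_k a k 0 *: delta_mx k 0.
  by rewrite [LHS]matrix_sum_delta; apply: eq_bigr => k _; rewrite big_ord1.
by apply: le_trans (norm_sum _ _ _) _; apply: ler_sum => k _; rewrite (normZ normN).
Qed.

Lemma norm_dist a b : `|N a - N b| <= N (a - b).
Proof.
have h x y : N x - N y <= N (x - y).
  by rewrite lerBlDr (le_trans _ (normD normN _ _)) // subrK.
by rewrite ler_norml h andbT lerNl opprB norm_sub h.
Qed.

Lemma mx_coord_le (a : 'rV[R]_d) k : `|a 0 k| <= `|a|.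
Proof.
rewrite [leRHS]/Num.norm /= mx_normrE.
by apply: (le_bigmax _ (fun ij : 'I_1 * 'I_d => `|a ij.1 ij.2|) (0, k)).
Qed.

(** Equivalence with the sup norm: [N] attains a positive minimum on the compact unit sphere of that
    norm. It makes the sets defining [dual_norm] and [op_norm] bounded, so that their [sup] is a
    genuine supremum and not a default value. *)
Lemma coord_le_norm : exists2 c, 0 < c & forall a k, `|a k 0| <= c * N a.
Proof.
pose f (v : 'rV[R]_d) := N v^T.
pose C := \sum_k N (delta_mx k 0 : 'cV[R]_d).
have C0 : 0 <= C by apply: sumr_ge0 => k _; exact: norm_ge0.
have f_le v : f v <= C * `|v|.
  apply: le_trans (norm_coord_le _) _; rewrite mulr_suml; apply: ler_sum => k _.
  by rewrite mulrC mxE ler_wpM2l ?norm_ge0 // mx_coord_le.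
have f_cont : continuous f.
  move=> v; apply/(@cvgrPdist_le _ _ _ _ (nbhs_filter v)) => e e0.
  have C1 : 0 < C + 1 by lra.
  apply/nbhs_ballP; exists (e / (C + 1)); first exact: divr_gt0.
  move=> u; rewrite -ball_normE /= => uv; apply: le_trans (norm_dist _ _) _.
  rewrite -[_^T - _]linearB /=; apply: le_trans (f_le _) _.
  apply: (@le_trans _ _ ((C + 1) * (e / (C + 1)))).
    by apply: ler_pM => //; [lra | exact: ltW].
  by rewrite mulrCA divff ?mulr1 // gt_eqF.
have [S0|/set0P S_n0] := eqVneq [set v : 'rV[R]_d | `|v| = 1] set0.
  exists 1 => // a k; rewrite mul1r; have [a0|an0] := eqVneq a 0.
    by rewrite a0 norm0 mxE normr0.
  have nz : `|a^T| != 0 by rewrite normr_eq0 -(inj_eq (can_inj (@trmxK _ _ _))) trmx0 trmxK.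
  have : [set v : 'rV[R]_d | `|v| = 1] (`|a^T|^-1 *: a^T).
    by rewrite /= normrZ normfV normr_id mulVf.
  by rewrite S0.
have S_compact : compact [set v : 'rV[R]_d | `|v| = 1].
  apply: bounded_closed_compact.
    by exists 1; split=> // M M1 v /= ->; exact: ltW.
  have -> : [set v : 'rV[R]_d | `|v| = 1] = Num.norm @^-1` [set (1 : R)] by [].
  by apply: closed_comp => [v _|]; [exact: norm_continuous | exact: closed_eq].
have [|c cS cmin] := compact_EVT_min S_n0 S_compact (f := f).
  exact: continuous_subspaceT.
have fc0 : 0 < f c.
  rewrite lt_neqAle norm_ge0 andbT eq_sym; apply/eqP => /(norm_eq0 normN) c0.
  move: cS; rewrite inE /= -[c]trmxK c0 trmx0 normr0 => /eqP.
  by rewrite eq_sym oner_eq0.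
exists (f c)^-1 => [|a k]; first by rewrite invr_gt0.
have [a0|an0] := eqVneq a 0; first by rewrite a0 norm0 mxE normr0 mulr0.
have nz : `|a^T| != 0 by rewrite normr_eq0 -(inj_eq (can_inj (@trmxK _ _ _))) trmx0 trmxK.
have nz0 : 0 < `|a^T| by rewrite lt_neqAle normr_ge0 eq_sym nz.
have := cmin (`|a^T|^-1 *: a^T); rewrite inE /= normrZ normfV normr_id mulVf //.
move=> /(_ erefl); rewrite [leRHS]/f linearZ /= trmxK (normZ normN) normfV normr_id => h.
rewrite ler_pdivlMl //.
have := mx_coord_le a^T k; rewrite mxE => hk.
apply: le_trans (ler_wpM2l (ltW fc0) hk) _.
by rewrite -ler_pdivlMr // mulrC.
Qed.

Lemma dotv_unit_bounded g : has_ubound [set dotv g a | a in [set a | N a <= 1]].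
Proof.
have [c c0 hc] := coord_le_norm.
exists (\sum_k `|g k 0| * c) => _ [a /= a1 <-].
apply: le_trans (ler_norm _) _; apply: le_trans (ler_norm_sum _ _ _) _.
apply: ler_sum => k _; rewrite normrM ler_wpM2l // (le_trans (hc _ _)) //.
by rewrite -[leRHS]mulr1 ler_wpM2l // ltW.
Qed.

Lemma dual_norm_ge0 g : 0 <= dual_norm N g.
Proof.
apply: ub_le_sup; first exact: dotv_unit_bounded.
exists 0; rewrite /= ?norm0 //; apply: big1 => k _; by rewrite mxE mulr0.
Qed.

Lemma dotv_le g a : dotv g a <= dual_norm N g * N a.
Proof.
have [/(norm_eq0 normN) ->|an0] := eqVneq (N a) 0.
  rewrite norm0 mulr0 /dotv big1 // => k _; by rewrite mxE mulr0.
have Na0 : 0 < N a by rewrite lt_neqAle norm_ge0 eq_sym an0.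
rewrite -ler_pdivrMr //; apply: ub_le_sup; first exact: dotv_unit_bounded.
exists ((N a)^-1 *: a); last by rewrite dotvZr mulrC.
by rewrite /= (normZ normN) normfV ger0_norm ?norm_ge0 // mulVf.
Qed.

Lemma dual_norm_opp g : dual_norm N (- g) = dual_norm N g.
Proof.
rewrite /dual_norm; congr sup; apply/seteqP; split=> _ [a /= a1 <-];
exists (- a); rewrite /= ?norm_opp // dotvNr ?dotvNl ?opprK //.
Qed.

Lemma norm_mulmx_le (B : 'M[R]_d) a : op_norm N B <= 1 -> N (B *m a) <= N a.
Proof.
move=> B1; have [c c0 hc] := coord_le_norm.
have bnd : has_ubound [set N (B *m b) | b in [set b | N b <= 1]].
  exists (\sum_k (\sum_l `|B k l| * c) * N (delta_mx k 0)) => _ [b /= b1 <-].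
  apply: le_trans (norm_coord_le _) _; apply: ler_sum => k _.
  rewrite ler_wpM2r ?norm_ge0 // mxE; apply: le_trans (ler_norm_sum _ _ _) _.
  apply: ler_sum => l _; rewrite normrM ler_wpM2l // (le_trans (hc _ _)) //.
  by rewrite -[leRHS]mulr1 ler_wpM2l // ltW.
have [/(norm_eq0 normN) ->|an0] := eqVneq (N a) 0; first by rewrite mulmx0 norm0.
have Na0 : 0 < N a by rewrite lt_neqAle norm_ge0 eq_sym an0.
rewrite -[leRHS]mul1r -ler_pdivrMr //; apply: le_trans B1; apply: ub_le_sup => //.
exists ((N a)^-1 *: a).
  by rewrite /= (normZ normN) normfV ger0_norm ?norm_ge0 // mulVf.
by rewrite -scalemxAr (normZ normN) normfV ger0_norm ?norm_ge0 // mulrC.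
Qed.

End Norm.

Section ConvexSets.
Context {R : realType} {d : nat}.
Variable X : set 'cV[R]_d.
Hypothesis cvxX : convex_set X.

Lemma convex_set2 (s : R) a b : 0 <= s -> s <= 1 -> X a -> X b ->
  X (s *: a + (1 - s) *: b).
Proof.
move=> s0 s1 Xa Xb; have := cvxX (Itv01 s0 s1) (mem_set Xa) (mem_set Xb).
by rewrite inE.
Qed.

Lemma convex_set_sum n (s : 'I_n -> R) (a : 'I_n -> 'cV[R]_d) :
  in_simplex s -> (forall i, X (a i)) -> X (\sum_i s i *: a i).
Proof.
move=> [s0 s1] Xa.
(* Partial sums of the weights are not 1, so the induction runs over normalised partial combinations
   of positive total weight. *)
suff H (r : seq 'I_n) : 0 < \sum_(i <- r) s i ->
    X ((\sum_(i <- r) s i)^-1 *: \sum_(i <- r) s i *: a i).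
  by have := H (index_enum 'I_n); rewrite s1 invr1 scale1r; apply.
elim: r => [|i r IH]; first by rewrite big_nil ltxx.
rewrite !big_cons; set S := \sum_(j <- r) s j; set V := \sum_(j <- r) _ => SS.
have S0 : 0 <= S by apply: sumr_ge0.
have [Sz|Sn] := eqVneq S 0.
  have -> : V = 0.
    rewrite /V big_seq big1 // => j jr; suff -> : s j = 0 by rewrite scale0r.
    apply/le_anti; rewrite s0 andbT -Sz /S (big_rem j) //= lerDl; exact: sumr_ge0.
  move: SS; rewrite Sz !addr0 => si0.
  by rewrite scalerA mulVf ?scale1r // gt_eqF.
have Sgt : 0 < S by rewrite lt_neqAle eq_sym Sn.
have -> : (s i + S)^-1 *: (s i *: a i + V) =
    (s i / (s i + S)) *: a i + (1 - s i / (s i + S)) *: (S^-1 *: V).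
  rewrite scalerDr !scalerA mulrC; congr (_ + _ *: _).
  by field; rewrite Sn gt_eqF.
apply: convex_set2 => //; last exact: IH.
- by rewrite divr_ge0 // ltW.
- by rewrite ler_pdivrMr // mul1r lerDl.
Qed.

End ConvexSets.

(** * Gradients and the mirror step *)

Section Gradient.
Context {R : realType} {d : nat}.
Implicit Types (h : 'cV[R]_d -> R) (a b v : 'cV[R]_d).

Lemma derive_dotv h b v : differentiable_at h b ->
  'D_v (h : 'cV[R]_d -> R^o) b = dotv (grad h b) v.
Proof.
move=> dh; rewrite deriveE //.
have {1}-> : v = \sum_k v k 0 *: delta_mx k 0.
  by rewrite [LHS]matrix_sum_delta; apply: eq_bigr => k _; rewrite big_ord1.
rewrite linear_sum; apply: eq_bigr => k _.
by rewrite linearZ /= mxE deriveE // mulrC.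
Qed.

Lemma grad_opp h b : differentiable_at h b -> grad (fun a => - h a) b = - grad h b.
Proof.
move=> dh; apply/colP => k; rewrite !mxE.
by rewrite (@deriveN _ _ _ (h : 'cV[R]_d -> R^o)) //; exact: diff_derivable.
Qed.

Lemma differentiable_at_opp h b : differentiable_at h b ->
  differentiable_at (fun a => - h a) b.
Proof. exact: differentiableN. Qed.

(** The quadratic term vanishes as s tends to 0. It is absent for convex functions and carries the
    modulus for strongly convex ones. *)
Lemma dotv_grad_le h b v c k : differentiable_at h b ->
  (forall s, 0 < s -> s <= 1 -> h (b + s *: v) - h b <= s * c + s ^+ 2 * k) ->
  dotv (grad h b) v <= c.
Proof.
move=> dh hs; rewrite leNgt; apply/negP => cD; set D := dotv _ _ in cD.
pose e := (D - c) / 2; have e0 : 0 < e by rewrite /e; lra.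
have Dcvg : (fun s : R => s^-1 *: (((h : _ -> R^o) \o shift b) (s *: v) - h b)) @ 0^' --> (D : R^o).
  by rewrite /D -derive_dotv //; exact: (diff_derivable (v := v) dh).
move/cvgrPdist_lt: Dcvg => /(_ e e0).
rewrite near_withinE => /nbhs_ballP[r /= r0 hr].
(* This [s] is in the range of the hypothesis, close enough to 0 for the difference quotient q to be
   within [e] of D, and has s k <= e. Then D < q + e <= c + 2 e = D. *)
pose s := Num.min (r / 2) (Num.min 1 (e / (`|k| + 1))).
have k1 : 0 < `|k| + 1 by rewrite ltr_wpDl.
have s0 : 0 < s by rewrite /s !lt_min ltr01 (divr_gt0 r0) ?(divr_gt0 e0) ?ltr0n.
have s1 : s <= 1 by rewrite !ge_min lexx orbT.
have sk : s * k <= e.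
  apply: le_trans (ler_norm _) _; rewrite normrM gtr0_norm //.
  apply: (@le_trans _ _ (e / (`|k| + 1) * `|k|)).
    by rewrite ler_wpM2r // !ge_min lexx !orbT.
  by rewrite mulrAC ler_pdivrMr // ler_wpM2l ?(ltW e0) // lerDl.
have sr : ball (0 : R) r s.
  rewrite -ball_normE /= sub0r normrN gtr0_norm //.
  by apply: (@le_lt_trans _ _ (r / 2)); [rewrite ge_min lexx | lra].
have := hr s sr (lt0r_neq0 s0); rewrite /= => /ltr_distlDr.
set q := _ *: _ => qD.
have : q <= c + s * k.
  have -> : q = (h (b + s *: v) - h b) / s.
    by rewrite /q /= [s *: v + b]addrC /GRing.scale /= mulrC.
  rewrite ler_pdivrMr //; apply: le_trans (hs s s0 s1) _.
  by have -> : s * c + s ^+ 2 * k = (c + s * k) * s by ring.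
by rewrite /e in qD sk; lra.
Qed.

Lemma dotv_grad_ge h b v c : differentiable_at h b ->
  (forall s, 0 < s -> s <= 1 -> s * c <= h (b + s *: v) - h b) ->
  c <= dotv (grad h b) v.
Proof.
move=> dh hs; rewrite -lerN2 -dotvNl -grad_opp //.
apply: (@dotv_grad_le _ _ _ _ 0); first exact: differentiable_at_opp.
by move=> s s0 s1; have := hs s s0 s1; lra.
Qed.

Lemma convex_grad h a b : convex_on_space h -> differentiable_at h b ->
  dotv (grad h b) (a - b) <= h a - h b.
Proof.
move=> ch dh; apply: (@dotv_grad_le _ _ _ _ 0) => // s s0 s1.
have : h (s *: a + (1 - s) *: b) <= s * h a + (1 - s) * h b.
  by apply: (ch (Itv01 (ltW s0) s1)); rewrite inE.
have -> : b + s *: (a - b) = s *: a + (1 - s) *: b.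
  by rewrite scalerBr scalerBl scale1r addrCA addrA.
lra.
Qed.

Lemma bregman_ge N X (rho : R) h a b : strongly_convex N X rho h ->
  differentiable_at h b -> X a -> X b ->
  rho / 2 * N (a - b) ^+ 2 <= bregman h a b.
Proof.
move=> sc dh Xa Xb; set w := rho / 2 * _.
suff : dotv (grad h b) (a - b) <= h a - h b - w by rewrite /bregman; lra.
apply: (@dotv_grad_le _ _ _ _ w) => // s s0 s1.
have := sc s a b (ltW s0) s1 Xa Xb.
have -> : b + s *: (a - b) = s *: a + (1 - s) *: b.
  by rewrite scalerBr scalerBl scale1r addrCA addrA.
rewrite /w; nra.
Qed.

End Gradient.

Section MirrorStep.
Context {R : realType} {d : nat}.
Variables (N h : 'cV[R]_d -> R) (X : set 'cV[R]_d) (rho : R).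
Hypothesis normN : is_norm N.
Hypothesis cvxX : convex_set X.
Hypothesis diff_h : forall a, differentiable_at h a.
Hypothesis rho0 : 0 < rho.
Hypothesis sc_h : strongly_convex N X rho h.
Variables (x z xt g : 'cV[R]_d) (alpha : R).
Hypothesis alpha0 : 0 < alpha.
Hypothesis Xx : X x.
Hypothesis grad_z : grad h z = grad h x - alpha *: g.
Hypothesis argmin_xt : is_argmin X (fun a => bregman h a z) xt.

Let Xxt : X xt. Proof. by case: argmin_xt. Qed.

(** First-order optimality of the Bregman projection, rewritten by the three-point identity; [z]
    survives only through its gradient, which [grad_z] eliminates. *)
Lemma projection_optimality u : X u ->
  alpha * dotv g (xt - u) <= bregman h u x - bregman h u xt - bregman h xt x.
Proof.
move=> Xu.
suff : dotv (grad h z) (u - xt) <= dotv (grad h xt) (u - xt).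
  rewrite grad_z /bregman !(dotvBl, dotvBr, dotvZl); lra.
apply: dotv_grad_ge => // s s0 s1.
have Xs : X (xt + s *: (u - xt)).
  have -> : xt + s *: (u - xt) = s *: u + (1 - s) *: xt.
    by rewrite scalerBr scalerBl scale1r addrCA addrA.
  by apply: convex_set2 => //; exact: ltW.
have [_ /(_ _ Xs)] := argmin_xt.
rewrite /bregman !(dotvBr, dotvDr, dotvZr); lra.
Qed.

(** Optimality against [u = x]: the divergences between [x] and [xt] in both orders are at least rho
    r^2 / 2, so that rho r^2 <= alpha ||g||_* r. *)
Lemma mirror_step_dist : N (xt - x) <= alpha * dual_norm N g / rho.
Proof.
have := projection_optimality Xx.
have := bregman_ge sc_h (diff_h xt) Xx Xxt.
have := bregman_ge sc_h (diff_h x) Xxt Xx.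
have := dotv_le normN g (x - xt); rewrite [N (x - xt)]norm_sub //.
have -> : bregman h x x = 0 by rewrite /bregman dotvBr !subrr.
have -> : dotv g (x - xt) = - dotv g (xt - x) by rewrite -dotvNr opprB.
have := norm_ge0 normN (xt - x); have := dual_norm_ge0 normN g.
set D := dual_norm N g; set r := N _ => D0 r0 h1 h2 h3 h4.
rewrite ler_pdivlMr //.
have h5 := ler_wpM2l (ltW alpha0) h1.
have : rho * r ^+ 2 <= alpha * (D * r) by lra.
have [->|rn0] := eqVneq r 0; first by rewrite mul0r mulr_ge0 // ltW.
have rp : 0 < r by rewrite lt_neqAle eq_sym rn0.
by rewrite expr2 !mulrA ler_pM2r // mulrC.
Qed.

Lemma mirror_step_regret u : X u ->
  dotv g (x - u) <= alpha * dual_norm N g ^+ 2 / (2 * rho)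
    + (bregman h u x - bregman h u xt) / alpha.
Proof.
move=> Xu; have := projection_optimality Xu.
have := bregman_ge sc_h (diff_h x) Xxt Xx.
have := dotv_le normN g (x - xt); rewrite [N (x - xt)]norm_sub //.
have -> : dotv g (x - u) = dotv g (x - xt) + dotv g (xt - u).
  by rewrite -dotvDr addrA subrK.
set D := dual_norm N g; set r := N _ => h1 h2 h3.
set b := bregman h u x - _ in h3 *.
have {}h3 : dotv g (xt - u) <= (b - rho / 2 * r ^+ 2) / alpha.
  by rewrite ler_pdivlMr // mulrC; lra.
(* AM-GM: [D r <= alpha D^2 / (2 rho) + rho r^2 / (2 alpha)] *)
have amgm : 0 <= (alpha * D / rho - r) ^+ 2 * (rho / (2 * alpha)).
  by rewrite mulr_ge0 ?sqr_ge0 // divr_ge0 ?mulr_ge0 // ltW.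
have E1 : (alpha * D / rho - r) ^+ 2 * (rho / (2 * alpha)) =
    alpha * D ^+ 2 / (2 * rho) + rho / 2 * r ^+ 2 / alpha - D * r.
  by field; rewrite !gt_eqF.
have E2 : (b - rho / 2 * r ^+ 2) / alpha = b / alpha - rho / 2 * r ^+ 2 / alpha.
  by rewrite mulrBl.
lra.
Qed.

End MirrorStep.

(** * Consensus error *)

Lemma consensus_rate_lt1 (R : realType) (n Q : nat) (zeta : R) : 'I_n ->
  0 < zeta -> zeta < 1 -> (0 < Q)%N ->
  (1 - zeta / (4 * n%:R ^+ 2)) `^ (1 / Q%:R) < 1.
Proof.
move=> i0 zeta0 zeta1 Q0.
have d0 := decay_gt0 zeta1 i0; have d1 := decay_lt1 zeta0 i0.
have p0 : 0 < 1 / Q%:R :> R by rewrite divr_gt0 // ltr0n.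
have := gt0_ltr_powR p0 _ _ d1.
by rewrite powR1; apply; rewrite nnegrE // ltW.
Qed.

Section Consensus.
Context {R : realType} {n d Q : nat}.
Variables (N : 'cV[R]_d -> R) (E : nat -> rel 'I_n) (A : nat -> 'M[R]_n) (zeta : R).
Hypothesis normN : is_norm N.
Hypothesis zeta0 : 0 < zeta.
Hypothesis zeta1 : zeta < 1.
Hypothesis netA : weighted_network E A zeta.
Hypothesis Q0 : (0 < Q)%N.
Hypothesis connE : jointly_connected E Q.
Variables (B : nat -> 'M[R]_d) (T : nat).
Variables (x xt : 'I_n -> nat -> 'cV[R]_d) (e : 'I_n -> nat -> R).
Hypothesis B_le1 : forall t, (1 <= t <= T)%N -> op_norm N (B t) <= 1.
Hypothesis xS : forall i t, (1 <= t <= T)%N ->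
  x i t.+1 = \sum_j A t i j *: (B t *m xt j t).
Hypothesis xt_x : forall i t, (1 <= t <= T)%N -> N (xt i t - x i t) <= e i t.
Variable i0 : 'I_n.

Let Gam : R := (1 - zeta / (4 * n%:R ^+ 2)) `^ ((1 - 2 * Q%:R) / Q%:R).
Let sig : R := (1 - zeta / (4 * n%:R ^+ 2)) `^ (1 / Q%:R).

(* The perturbation injected at time [s]; [s = 0] stands for the initial decisions,
   which propagate from time [1] like the perturbation of round [1]. *)
Let eps s j : R := if s is 0%N then N (x j 1) else e j s.
Let start s := maxn 1 s.

(** The matrices [B] act on coordinates and the weights on agents, so the two commute. The
    accumulated [B] are absorbed into [b], whose norms they do not increase, and only products of
    weights remain explicit. *)
Lemma consensus_expansion t : (t <= T)%N -> exists b : nat -> 'I_n -> 'cV[R]_d,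
  (forall s j, (s <= t)%N -> N (b s j) <= eps s j) /\
  forall i, x i t.+1 = \sum_(s < t.+1) \sum_j
    transition A (start s) (t.+1 - start s) i j *: b s j.
Proof.
elim: t => [|t IH] tT.
  exists (fun _ j => x j 1%N); split=> [[|//] j _ //|i].
  rewrite big_ord1 (_ : 1 - start _ = 0)%N //= (bigD1 i) //= mxE eqxx scale1r big1 ?addr0 //.
  by move=> j ji; rewrite mxE eq_sym (negPf ji) scale0r.
have [b [b_le xE]] := IH (ltnW tT).
have tT' : (1 <= t.+1 <= T)%N by [].
exists (fun s j => B t.+1 *m (if (s <= t)%N then b s j else xt j t.+1 - x j t.+1)).
split=> [s j st|i].
  apply: (le_trans (norm_mulmx_le normN _ (B_le1 tT'))).
  case: ifPn => [/b_le //|]; rewrite -ltnNge => ts.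
  by have -> : s = t.+1 by [apply/eqP; rewrite eqn_leq st]; exact: xt_x.
rewrite xS // big_ord_recr /= ltnn.
have -> : start t.+1 = t.+1 by exact/maxn_idPr.
rewrite subSnn /= addn0 mulmx1.
have -> : \sum_j A t.+1 i j *: (B t.+1 *m xt j t.+1) =
    \sum_l A t.+1 i l *: (B t.+1 *m x l t.+1)
    + \sum_j A t.+1 i j *: (B t.+1 *m (xt j t.+1 - x j t.+1)).
  rewrite -big_split; apply: eq_bigr => j _ /=.
  by rewrite -scalerDr -mulmxDr addrC subrK.
congr (_ + _).
under [LHS]eq_bigr => l _ do rewrite xE mulmx_sumr scaler_sumr.
rewrite exchange_big /=; apply: eq_bigr => s _.
have st : (start s <= t.+1)%N by rewrite geq_max /= ltnW.
rewrite -ltnS ltn_ord (subSn st) /=.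
under [LHS]eq_bigr => l _ do rewrite mulmx_sumr scaler_sumr.
rewrite exchange_big /=; apply: eq_bigr => j _.
rewrite mxE scaler_suml; apply: eq_bigr => l _.
by rewrite subnKC // -scalemxAr scalerA.
Qed.

Lemma consensus_deviation i t : (1 <= t <= T)%N ->
  N (x i t.+1 - average (x^~ t.+1))
  <= Gam * \sum_(s < t.+1) sig ^+ (t - start s) * \sum_j eps s j.
Proof.
move=> /andP[t1 tT]; have [b [b_le xE]] := consensus_expansion tT.
have start1 s : (1 <= start s)%N by rewrite leq_max.
have -> : average (x^~ t.+1) = \sum_(s < t.+1) \sum_j n%:R^-1 *: b s j.
  rewrite /average; under eq_bigr do rewrite xE.
  rewrite exchange_big scaler_sumr; apply: eq_bigr => s _ /=.
  rewrite exchange_big scaler_sumr; apply: eq_bigr => j _ /=.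
  by rewrite -scaler_suml (transition_col netA) // scale1r.
rewrite xE -sumrB mulr_sumr.
apply: le_trans (norm_sum normN _ _ _) _; apply: ler_sum => s _.
rewrite -sumrB mulrA mulr_sumr.
apply: le_trans (norm_sum normN _ _ _) _; apply: ler_sum => j _.
have st : (start s <= t)%N by rewrite geq_max t1 /= -ltnS.
rewrite -scalerBl (normZ normN); apply: ler_pM => //; first exact: norm_ge0.
  have := @transition_bound R n Q E A zeta zeta0 zeta1 netA Q0 connE (start s) j (start1 s)
    (t.+1 - start s) i.
  by rewrite subSn //=; apply.
by apply: b_le; rewrite -ltnS.
Qed.

(** Write W t for the convolution. Then W (t + 1) is sig times W t plus the new perturbations, and
    adding these relations gives the identity. At t = 1 both indices 0 and 1 carry exponent 0,
    because [start] sends both to 1. *)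
Lemma sum_geometric_convolution m : (1 <= m)%N ->
  (1 - sig) * \sum_(1 <= t < m.+1) \sum_(s < t.+1) sig ^+ (t - start s) * \sum_j eps s j
  + sig * \sum_(s < m.+1) sig ^+ (m - start s) * \sum_j eps s j
  = \sum_(s < m.+1) \sum_j eps s j.
Proof.
case: m => [//|m _]; elim: m => [|m IH].
  rewrite big_nat1 !big_ord_recr !big_ord0 /=.
  have -> : (1 - start 0 = 0)%N by [].
  ring.
have WS : \sum_(s < m.+3) sig ^+ (m.+2 - start s) * \sum_j eps s j =
    sig * (\sum_(s < m.+2) sig ^+ (m.+1 - start s) * \sum_j eps s j) + \sum_j eps m.+2 j.
  rewrite big_ord_recr /=; congr (_ + _); last by rewrite subnn mul1r.
  rewrite mulr_sumr; apply: eq_bigr => s _.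
  have st : (start s <= m.+1)%N by rewrite geq_max /= -ltnS.
  by rewrite (subSn st) exprS mulrA.
rewrite [in LHS]big_nat_recr //= mulrDr -addrA -mulrDl subrK mul1r.
by rewrite WS addrA IH [RHS]big_ord_recr.
Qed.

Let sig01 : 0 <= sig < 1.
Proof. by rewrite powR_ge0 (consensus_rate_lt1 i0). Qed.

Lemma consensus_total : (1 <= T)%N ->
  \sum_(1 <= t < T.+1) \sum_i N (x i t - average (x^~ t))
  <= \sum_i N (x i 1%N - average (x^~ 1%N))
     + Gam / (1 - sig) * (n%:R * (\sum_i N (x i 1%N) + \sum_(1 <= t < T.+1) \sum_i e i t)).
Proof.
move=> T1; rewrite big_nat_recl // lerD2l.
have /andP[s0 s1] := sig01.
have G0 : 0 <= Gam by exact: powR_ge0.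
have eps_ge0 s j : (s <= T)%N -> 0 <= eps s j.
  case: s => [_|s sT]; first exact: norm_ge0.
  exact: le_trans (norm_ge0 normN _) (@xt_x j s.+1 sT).
have -> : \sum_i N (x i 1%N) + \sum_(1 <= t < T.+1) \sum_i e i t = \sum_(s < T.+1) \sum_j eps s j.
  rewrite -(big_mkord xpredT (fun s => \sum_j eps s j)) big_nat_recl //= big_add1.
  by congr (_ + _).
case: T T1 eps_ge0 consensus_deviation => [//|[_ eg _|m _ eg cd]].
  rewrite big_geq // mulr_ge0 ?divr_ge0 ?subr_ge0 ?(ltW s1) // mulr_ge0 //.
  by apply: sumr_ge0 => s _; apply: sumr_ge0 => j _; apply: eg; rewrite -ltnS.
apply: (@le_trans _ _ (n%:R * (Gam * \sum_(1 <= t < m.+2) \sum_(s < t.+1)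
    sig ^+ (t - start s) * \sum_j eps s j))).
  rewrite !mulr_sumr; apply: ler_sum_nat => t /andP[t1 tm].
  have -> : n%:R * (Gam * (\sum_(s < t.+1) sig ^+ (t - start s) * \sum_j eps s j))
     = \sum_(i < n) (Gam * \sum_(s < t.+1) sig ^+ (t - start s) * \sum_j eps s j).
    by rewrite sumr_const card_ord [LHS]mulr_natl.
  by apply: ler_sum => i _; apply: cd; rewrite t1 ltnW.
rewrite mulrCA -mulrA ler_wpM2l // [leRHS]mulrCA ler_wpM2l //.
rewrite mulrC ler_pdivlMr ?subr_gt0 // mulrC.
apply: (@le_trans _ _ (\sum_(s < m.+2) \sum_j eps s j)).
  rewrite -(sum_geometric_convolution (ltn0Sn m)) lerDl; apply: mulr_ge0 => //.
  apply: sumr_ge0 => s _; apply: mulr_ge0; first exact: exprn_ge0.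
  apply: sumr_ge0 => j _.
  by have := eg s j; apply; rewrite ltnW.
(* The perturbation of the last round only affects decisions beyond the horizon; it enters the bound
   as a nonnegative term. *)
rewrite [leRHS]big_ord_recr /= lerDl sumr_ge0 // => j _.
exact: (eg m.+2 j (leqnn _)).
Qed.

End Consensus.

(** * Telescoping of the divergences *)

Lemma weighted_telescope (R : realFieldType) (p a : nat -> R) (c : R) (T : nat) :
  (1 <= T)%N ->
  (forall t, (1 <= t <= T.+1)%N -> 0 <= p t <= c) ->
  (forall t, (1 <= t <= T)%N -> 0 < a t) ->
  (forall t, (1 <= t < T)%N -> a t.+1 <= a t) ->
  \sum_(1 <= t < T.+1) (p t - p t.+1) / a t <= c / a T.
Proof.
case: T => [//|T] _ pc a0 a_decr.
(* Keeping the last potential divided by its own step size makes the bound inductive: replacing that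
   step size by the next one adds p (1 / a' - 1 / a) on the left and c (1 / a' - 1 / a) on the
   right, with p <= c. *)
suff H m : (m <= T)%N ->
    \sum_(1 <= t < m.+2) (p t - p t.+1) / a t + p m.+2 / a m.+1 <= c / a m.+1.
  apply: le_trans (H T (leqnn T)); rewrite lerDl divr_ge0 //.
    by have /andP[] := pc T.+2 (leqnn _).
  by apply/ltW/a0; rewrite /= leqnn.
elim: m => [_|m IH mT].
  rewrite big_nat1 -mulrDl subrK ler_pM2r ?invr_gt0 ?a0 //.
  by have /andP[] := pc 1%N isT.
have {}IH := IH (ltnW mT).
rewrite big_nat_recr //= -addrA -mulrDl subrK.
have /andP[p0 pC] : 0 <= p m.+2 <= c by apply: pc; rewrite /= !ltnS ltnW.
have a1 : 0 < a m.+1 by apply: a0; rewrite /= ltnS ltnW.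
have a2 : 0 < a m.+2 by apply: a0.
have : (a m.+1)^-1 <= (a m.+2)^-1 by rewrite lef_pV2 ?posrE ?a_decr.
move: IH; set S := \sum_(_ <= _ < _) _; nra.
Qed.

Section MirrorTotal.
Context {R : realType} {n d : nat}.
Variables (N h : 'cV[R]_d -> R) (X : set 'cV[R]_d) (MX rho K : R).
Variables (A : nat -> 'M[R]_n) (B : nat -> 'M[R]_d) (alpha : nat -> R) (T : nat).
Hypothesis normN : is_norm N.
Hypothesis diamX : diam_le N X MX.
Hypothesis rho0 : 0 < rho.
Hypothesis diff_h : forall a, differentiable_at h a.
Hypothesis sc_h : strongly_convex N X rho h.
Hypothesis lip_h : bregman_lipschitz N X h K.
Hypothesis cvxr_h : bregman_convex_right n h.
Hypothesis stochA : forall t, (1 <= t)%N -> doubly_stochastic (A t).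
Hypothesis predB : forall t, (1 <= t <= T)%N -> good_prediction N X h (B t).
Hypothesis alpha0 : forall t, (1 <= t <= T)%N -> 0 < alpha t.
Hypothesis alpha_decr : forall t, (1 <= t < T)%N -> alpha t.+1 <= alpha t.
Variables (x xt g : 'I_n -> nat -> 'cV[R]_d) (u : nat -> 'cV[R]_d).
Hypothesis Xx : forall i t, (1 <= t <= T.+1)%N -> X (x i t).
Hypothesis Xxt : forall i t, (1 <= t <= T)%N -> X (xt i t).
Hypothesis Xu : forall t, (1 <= t)%N -> X (u t).
Hypothesis xS : forall i t, (1 <= t <= T)%N ->
  x i t.+1 = \sum_j A t i j *: (B t *m xt j t).
Hypothesis step : forall i t a, (1 <= t <= T)%N -> X a ->
  dotv (g i t) (x i t - a) <= alpha t * dual_norm N (g i t) ^+ 2 / (2 * rho)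
    + (bregman h a (x i t) - bregman h a (xt i t)) / alpha t.

(** The supremum is finite: the divergence vanishes on the diagonal and is Lipschitz in its first
    argument on a set of bounded diameter. *)
Lemma bregman_le_max a b : X a -> X b -> bregman h a b <= bregman_max h X.
Proof.
move=> Xa Xb; apply: ub_le_sup; last by exists (a, b).
exists (`|K| * MX) => _ [[a' b'] [/= Xa' Xb'] <-].
have := lip_h Xa' Xb' Xb'.
have -> : bregman h b' b' = 0 by rewrite /bregman dotvBr !subrr.
rewrite subr0 => h1; apply: le_trans (ler_norm _) _; apply: le_trans h1 _.
apply: (@le_trans _ _ (`|K| * N (a' - b'))).
  by rewrite ler_wpM2r ?norm_ge0 // ler_norm.
by rewrite ler_wpM2l // diamX.
Qed.

Lemma bregman_max_ge0 a : X a -> 0 <= bregman_max h X.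
Proof.
move=> Xa; apply: le_trans (bregman_le_max Xa Xa).
by rewrite /bregman dotvBr !subrr.
Qed.

(** The sign of [K] is not given, and on a one-point set it may be negative; the product is what can
    be proved nonnegative. *)
Lemma bregman_lipschitz_ge0 a b : X a -> X b -> 0 <= K * N (a - b).
Proof. by move=> Xa Xb; apply: le_trans (lip_h Xa Xb Xb). Qed.

(** Three moves: applying [B t] to both arguments does not increase the divergence; mixing is free
    after summation over agents, by convexity in the second argument and unit column sums; moving
    the first argument from [B t *m u t] to [u t.+1] costs the drift. *)
Lemma prediction_potential_step t : (1 <= t <= T)%N ->
  \sum_i (bregman h (u t) (x i t) - bregman h (u t) (xt i t))
  <= \sum_i bregman h (u t) (x i t) - \sum_i bregman h (u t.+1) (x i t.+1)
     + n%:R * K * N (u t.+1 - B t *m u t).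
Proof.
move=> tT; have /andP[t1 _] := tT; have [A0 Arow Acol] := stochA t1.
have [nexp _ stab] := predB tT; have Xut := Xu t1.
have h1 : \sum_i bregman h (B t *m u t) (B t *m xt i t) <= \sum_i bregman h (u t) (xt i t).
  by apply: ler_sum => i _; apply: nexp => //; exact: Xxt.
have h2 : \sum_i bregman h (B t *m u t) (x i t.+1)
    <= \sum_i bregman h (B t *m u t) (B t *m xt i t).
  apply: (@le_trans _ _ (\sum_i \sum_j A t i j * bregman h (B t *m u t) (B t *m xt j t))).
    apply: ler_sum => i _; rewrite xS //.
    exact: (@cvxr_h _ (fun j => B t *m xt j t) (A t i)).
  rewrite exchange_big /=; apply: ler_sum => j _.
  by rewrite -mulr_suml Acol mul1r.
have h3 : \sum_i bregman h (u t.+1) (x i t.+1)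
    <= \sum_i bregman h (B t *m u t) (x i t.+1) + n%:R * K * N (u t.+1 - B t *m u t).
  have -> : n%:R * K * N (u t.+1 - B t *m u t) = \sum_(i < n) K * N (u t.+1 - B t *m u t).
    by rewrite sumr_const card_ord -mulrA [LHS]mulr_natl.
  rewrite -big_split /=; apply: ler_sum => i _; rewrite -lerBlDl.
  apply: le_trans (ler_norm _) _; apply: lip_h; [exact: Xu | exact: stab |].
  by apply: Xx; have /andP[_] := tT; rewrite ltnS.
rewrite sumrB; lra.
Qed.

Lemma mirror_total : (1 <= T)%N ->
  \sum_(1 <= t < T.+1) \sum_i dotv (g i t) (x i t - u t)
  <= \sum_(1 <= t < T.+1) \sum_i alpha t * dual_norm N (g i t) ^+ 2 / (2 * rho)
     + (n%:R * bregman_max h X / alpha T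
        + n%:R * K * \sum_(1 <= t < T.+1) (alpha t)^-1 * N (u t.+1 - B t *m u t)).
Proof.
move=> T1; pose p t := \sum_i bregman h (u t) (x i t).
have p_bnd t : (1 <= t <= T.+1)%N -> 0 <= p t <= n%:R * bregman_max h X.
  move=> tT; have /andP[t1 _] := tT; apply/andP; split.
    apply: sumr_ge0 => i _; have := bregman_ge sc_h (diff_h (x i t)) (Xu t1) (Xx i tT).
    by apply: le_trans; rewrite mulr_ge0 ?sqr_ge0 // divr_ge0 // ltW.
  rewrite mulr_natl -[X in _ *+ X](card_ord n) -sumr_const.
  by apply: ler_sum => i _; apply: bregman_le_max; [exact: Xu | exact: Xx].
have := weighted_telescope T1 p_bnd alpha0 alpha_decr; move=> tele.
rewrite -lerBlDl; apply: (@le_trans _ _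
   (\sum_(1 <= t < T.+1) (p t - p t.+1) / alpha t
    + n%:R * K * \sum_(1 <= t < T.+1) (alpha t)^-1 * N (u t.+1 - B t *m u t))); last first.
  by rewrite lerD2r.
rewrite -sumrB mulr_sumr -big_split /=; apply: ler_sum_nat => t /andP[t1 tT].
have tT' : (1 <= t <= T)%N by rewrite t1 -ltnS.
rewrite lerBlDl; apply: (@le_trans _ _ (\sum_i (alpha t * dual_norm N (g i t) ^+ 2 / (2 * rho)
    + (bregman h (u t) (x i t) - bregman h (u t) (xt i t)) / alpha t))).
  by apply: ler_sum => i _; apply: step => //; exact: Xu.
rewrite big_split /= lerD2l -mulr_suml.
have -> : (p t - p t.+1) / alpha t + n%:R * K * ((alpha t)^-1 * N (u t.+1 - B t *m u t))
    = (p t - p t.+1 + n%:R * K * N (u t.+1 - B t *m u t)) / alpha t by ring.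
by rewrite ler_pM2r ?invr_gt0 ?alpha0 // prediction_potential_step.
Qed.

End MirrorTotal.

(** * Trajectory of one of the two players *)

Section Side.
Context {R : realType} {disp : measure_display} {Omega : measurableType disp} {n d Q : nat}.
Variables (N h : 'cV[R]_d -> R) (X : set 'cV[R]_d) (MX rho K zeta : R).
Variables (E : nat -> rel 'I_n) (A : nat -> 'M[R]_n).
Variables (B : nat -> 'M[R]_d) (alpha : nat -> R) (T : nat) (x1 : 'I_n -> 'cV[R]_d).
Variables (dir : 'I_n -> nat -> Omega -> 'cV[R]_d) (p : iterates (R := R) Omega n d).
Hypothesis normN : is_norm N.
Hypothesis cvxX : convex_set X.
Hypothesis diamX : diam_le N X MX.
Hypothesis zeta0 : 0 < zeta.
Hypothesis zeta1 : zeta < 1.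
Hypothesis netA : weighted_network E A zeta.
Hypothesis Q0 : (0 < Q)%N.
Hypothesis connE : jointly_connected E Q.
Hypothesis rho0 : 0 < rho.
Hypothesis diff_h : forall a, differentiable_at h a.
Hypothesis sc_h : strongly_convex N X rho h.
Hypothesis lip_h : bregman_lipschitz N X h K.
Hypothesis cvxr_h : bregman_convex_right n h.
Hypothesis predB : forall t, (1 <= t <= T)%N -> good_prediction N X h (B t).
Hypothesis alpha0 : forall t, (1 <= t <= T)%N -> 0 < alpha t.
Hypothesis alpha_decr : forall t, (1 <= t < T)%N -> alpha t.+1 <= alpha t.
Hypothesis Xx1 : forall i, X (x1 i).
Hypothesis run : mirror_run X h E A B alpha T x1 dir p.

Local Notation x := (decision p).
Local Notation xt := (projected p).

Lemma run_projected_in i t w : (1 <= t <= T)%N -> X (xt i t w).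
Proof. by move=> /(run_project run i w)[]. Qed.

Lemma run_predicted_in i t w : (1 <= t <= T)%N -> X (predicted p i t w).
Proof.
move=> tT; rewrite (run_predict run) //; have [_ _ st] := predB tT.
by apply: st; exact: run_projected_in.
Qed.

Lemma run_decision_predicted i t w : (1 <= t <= T)%N ->
  x i t.+1 w = \sum_j A t i j *: predicted p j t w.
Proof.
move=> tT; rewrite (run_consensus run) // big_mkcond; apply: eq_bigr => j _ /=.
case: ifPn => // jN; have /andP[t1 _] := tT; have [_ /(_ i j)[_ A0]] := netA t1.
by rewrite A0 // scale0r.
Qed.

Lemma run_decisionS i t w : (1 <= t <= T)%N ->
  x i t.+1 w = \sum_j A t i j *: (B t *m xt j t w).
Proof.
move=> tT; rewrite run_decision_predicted //; apply: eq_bigr => j _.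
by rewrite (run_predict run).
Qed.

Lemma run_decision_in i t w : (1 <= t <= T.+1)%N -> X (x i t w).
Proof.
case: t => [//|[|t]] tT; first by rewrite (run_init run).
have tT' : (1 <= t.+1 <= T)%N by [].
rewrite run_decision_predicted //; have [[A0 Ar _] _] := @netA t.+1 isT.
by apply: convex_set_sum => // j; exact: run_predicted_in.
Qed.

(** The mirror-step lemmas describe a descent, while [dir] is the direction followed. Hence [- dir]
    below: the stochastic gradient of f for the first player, of - f for the second. *)
Let grad_mirrored i t w : (1 <= t <= T)%N ->
  grad h (mirrored p i t w) = grad h (x i t w) - alpha t *: - dir i t w.
Proof. by move=> tT; rewrite (run_mirror run) // scalerN opprK. Qed.

Lemma run_decision_in_horizon i t w : (1 <= t <= T)%N -> X (x i t w).
Proof. by move=> /andP[t1 tT]; apply: run_decision_in; rewrite t1 ltnW. Qed.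

Lemma run_mirror_total u w : (1 <= T)%N -> (forall t, (1 <= t)%N -> X (u t)) ->
  \sum_(1 <= t < T.+1) \sum_i dotv (- dir i t w) (x i t w - u t)
  <= \sum_(1 <= t < T.+1) \sum_i alpha t * dual_norm N (- dir i t w) ^+ 2 / (2 * rho)
     + (n%:R * bregman_max h X / alpha T
        + n%:R * K * \sum_(1 <= t < T.+1) (alpha t)^-1 * N (u t.+1 - B t *m u t)).
Proof.
move=> T1 Xu.
apply: (@mirror_total R n d N h X MX rho K A B alpha T _ _ _ _ _ _ _ _ _ _ _
  (fun i t => x i t w) (fun i t => xt i t w) (fun i t => - dir i t w)) => //.
- by move=> t /netA[].
- by move=> i t; exact: run_decision_in.
- by move=> i t; exact: run_projected_in.
- by move=> i t; exact: run_decisionS.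
- move=> i t a tT Xa; 
  apply: (@mirror_step_regret _ _ _ _ X rho _ _ _ _ _ _ (mirrored p i t w)) => //.
  + exact: alpha0.
  + exact: run_decision_in_horizon.
  + exact: grad_mirrored.
  + exact: (run_project run i w tT).
Qed.

Let Gam : R := (1 - zeta / (4 * n%:R ^+ 2)) `^ ((1 - 2 * Q%:R) / Q%:R).
Let sig : R := (1 - zeta / (4 * n%:R ^+ 2)) `^ (1 / Q%:R).

Lemma run_consensus_total (i0 : 'I_n) w : (1 <= T)%N ->
  \sum_(1 <= t < T.+1) \sum_i N (x i t w - average (fun i => x i t w))
  <= \sum_i N (x1 i - average x1)
     + Gam / (1 - sig) * (n%:R * (\sum_i N (x1 i)
         + \sum_(1 <= t < T.+1) \sum_i alpha t * dual_norm N (- dir i t w) / rho)).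
Proof.
move=> T1.
have -> : x1 = (fun i => x i 1%N w) by apply/funext => i; rewrite (run_init run).
apply: (@consensus_total R n d Q N E A zeta normN zeta0 zeta1 netA Q0 connE B T
  (fun i t => x i t w) (fun i t => xt i t w)
  (fun i t => alpha t * dual_norm N (- dir i t w) / rho)) => //.
- by move=> t /predB[].
- by move=> i t; exact: run_decisionS.
- move=> i t tT; apply: (@mirror_step_dist _ _ _ _ X rho _ _ _ _ _ _ (mirrored p i t w)) => //.
  + exact: alpha0.
  + exact: run_decision_in_horizon.
  + exact: grad_mirrored.
  + exact: (run_project run i w tT).
Qed.

End Side.

(** * Saddle-point gap *)

Lemma convex_grad_lipschitz (R : realType) d (N h : 'cV[R]_d -> R) (L : R) a b :
  is_norm N -> convex_on_space h -> differentiable_at h a ->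
  dual_norm N (grad h a) <= L -> h a - h b <= L * N (a - b).
Proof.
move=> nN ch dh hL; have := convex_grad b ch dh.
rewrite -[b - a]opprB dotvNr => h1.
have h2 := dotv_le nN (grad h a) (a - b).
have h3 := ler_wpM2r (norm_ge0 nN (a - b)) hL; lra.
Qed.

Section SaddleGap.
Context {R : realType} {n d m : nat}.
Variables (Nx : 'cV[R]_d -> R) (Ny : 'cV[R]_m -> R) (X : set 'cV[R]_d) (Y : set 'cV[R]_m).
Variables (F : 'I_n -> 'cV[R]_d -> 'cV[R]_m -> R) (LX LY : R).
Hypothesis normNx : is_norm Nx.
Hypothesis normNy : is_norm Ny.
Hypothesis cvxY : convex_set Y.
Hypothesis LX0 : 0 <= LX.
Hypothesis LY0 : 0 <= LY.
Hypothesis cvxF : forall i y, convex_on_space (fun x => F i x y).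
Hypothesis ccvF : forall i x, convex_on_space (fun y => - F i x y).
Hypothesis diffFx : forall i x y, X x -> Y y -> differentiable_at (fun x' => F i x' y) x.
Hypothesis diffFy : forall i x y, X x -> Y y -> differentiable_at (fun y' => F i x y') y.
Hypothesis gradFx_le : forall i x y, X x -> Y y ->
  dual_norm Nx (grad (fun x' => F i x' y) x) <= LX.
Hypothesis gradFy_le : forall i x y, X x -> Y y ->
  dual_norm Ny (grad (fun y' => F i x y') y) <= LY.

Let lipx i x x' y : X x -> Y y -> F i x y - F i x' y <= LX * Nx (x - x').
Proof.
move=> Xx Yy; apply: (convex_grad_lipschitz _ normNx (cvxF i y)) => //.
- exact: diffFx.
- exact: gradFx_le.
Qed.

Let lipy i x y y' : X x -> Y y' -> F i x y - F i x y' <= LY * Ny (y - y').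
Proof.
move=> Xx Yy; rewrite [Ny _]norm_sub //.
have -> : F i x y - F i x y' = - F i x y' - - F i x y by rewrite opprK addrC.
apply: (convex_grad_lipschitz _ normNy (ccvF i x)) => //.
- exact/differentiable_at_opp/diffFy.
- by rewrite grad_opp ?dual_norm_opp //; [exact: gradFy_le | exact: diffFy].
Qed.

Variables (xs : 'cV[R]_d) (ys : 'cV[R]_m).
Hypothesis saddle : saddle_point X Y (fun x y => \sum_i F i x y) xs ys.
Variables (x : 'I_n -> 'cV[R]_d) (y : 'I_n -> 'cV[R]_m).
Hypothesis Xx : forall i, X (x i).
Hypothesis Yy : forall i, Y (y i).

(** The deviation of [j] is counted n times and each is at most the whole sum; the deviations of the
    other agents add that sum once more. *)
Let spread_le d' (N : 'cV[R]_d' -> R) (a : 'I_n -> 'cV[R]_d') j : is_norm N ->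
  \sum_i N (a j - a i) <= (n%:R + 1) * \sum_i N (a i - average a).
Proof.
move=> nN; set S := \sum_i N (a i - average a).
have aj : N (a j - average a) <= S.
  rewrite /S (bigD1 j) //= lerDl; apply: sumr_ge0 => i _; exact: norm_ge0.
have -> : (n%:R + 1) * S = \sum_(i < n) (S + N (a i - average a)).
  by rewrite big_split /= sumr_const card_ord mulrDl mul1r [_%:R * _]mulr_natl.
apply: ler_sum => i _; rewrite [N (a i - _)]norm_sub //.
have -> : a j - a i = (a j - average a) + (average a - a i) by rewrite addrA subrK.
by apply: le_trans (normD nN _ _) _; rewrite lerD2r.
Qed.

(* The saddle value is bounded below by the payoff at (xs, average y) rather than at
   (xs, y j): this is what yields the factor n + 2. *)
Lemma saddle_gap_le j :
  \sum_i F i (x j) (y j) - \sum_i F i xs ys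
  <= \sum_i dotv (grad (fun x' => F i x' (y i)) (x i)) (x i - xs)
     + (n%:R + 2) * (LX * \sum_i Nx (x i - average x) + LY * \sum_i Ny (y i - average y)).
Proof.
have [Xxs _ sad] := saddle.
have n_gt0 : (0 < n)%N by exact: leq_ltn_trans (ltn_ord j).
have Yavg : Y (average y).
  rewrite /average scaler_sumr; apply: convex_set_sum => //; split=> [i|].
    by rewrite invr_ge0.
  by rewrite sumr_const card_ord -[LHS]mulr_natl divff // pnatr_eq0 -lt0n.
have [savg _] := sad xs (average y) Xxs Yavg.
have gap : \sum_i F i (x j) (y j) - \sum_i F i xs (average y) <=
   \sum_i dotv (grad (fun x' => F i x' (y i)) (x i)) (x i - xs)
   + LX * \sum_i Nx (x j - x i) + LY * \sum_i Ny (y j - y i) + LY * \sum_i Ny (y i - average y).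
  rewrite -sumrB !mulr_sumr -!big_split /=; apply: ler_sum => i _.
  have h1 := @lipx i (x j) (x i) (y j) (Xx j) (Yy j).
  have h2 := @lipy i (x i) (y j) (y i) (Xx i) (Yy i).
  have h3 := convex_grad xs (cvxF i (y i)) (diffFx i (Xx i) (Yy i)).
  have h4 := @lipy i xs (y i) (average y) Xxs Yavg.
  move: h3; rewrite -[xs - x i]opprB dotvNr; lra.
have hx := ler_wpM2l LX0 (spread_le x j normNx).
have hy := ler_wpM2l LY0 (spread_le y j normNy).
(* The x-errors only come with n + 1; nonnegativity allows rounding up to the n + 2 of the
   y-errors. *)
have Sx0 : 0 <= LX * \sum_i Nx (x i - average x).
  by rewrite mulr_ge0 //; apply: sumr_ge0 => i _; exact: norm_ge0.
set Sx := \sum_i Nx (x i - average x) in Sx0 hx *.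
set Sy := \sum_i Ny (y i - average y) in hy gap *.
lra.
Qed.

End SaddleGap.

(** * Means and orthogonality *)

(* No measurability is assumed: the integral is a difference of suprema over simple
   functions below the positive and the negative part, hence monotone. *)
Lemma le_integral_pointwise d (T : measurableType d) (R : realType)
    (mu : {measure set T -> \bar R}) (f g : T -> \bar R) :
  (forall w, f w <= g w)%E -> (\int[mu]_w f w <= \int[mu]_w g w)%E.
Proof.
move=> fg.
rewrite /integral !patch_setT; apply: leeB; apply: ereal_sup_le => _ [h hf <-];
exists h => // w; apply: le_trans (hf w) _.
- by apply: (@funepos_le _ _ setT) => [x _|]; rewrite ?inE.
- by apply: (@funeneg_le _ _ setT) => [x _|]; rewrite ?inE.
Qed.

Section Mean.
Context {R : realType} {disp : measure_display} {Omega : measurableType disp}.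
Variable P : probability Omega R.

Definition has_mean (U : Omega -> R) (c : R) : Prop :=
  P.-integrable [set: Omega] (EFin \o U) /\ (\int[P]_w (U w)%:E = c%:E)%E.

Lemma integrable_has_mean U : P.-integrable [set: Omega] (EFin \o U) ->
  exists c, has_mean U c.
Proof.
move=> iU; exists (fine (\int[P]_w (U w)%:E)%E); split=> //.
by rewrite fineK //; exact: integrable_fin_num.
Qed.

Lemma has_mean_cst c : has_mean (fun=> c) c.
Proof.
split; first exact: finite_measure_integrable_cst.
by rewrite integral_cst // [X in (_ * X)%E]probability_setT mule1.
Qed.

Lemma has_meanD U V c c' : has_mean U c -> has_mean V c' ->
  has_mean (fun w => U w + V w) (c + c').
Proof.
move=> [iU EU] [iV EV]; split.
  by have := integrableD measurableT iU iV; apply: eq_integrable.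
by rewrite EFinD -EU -EV; exact: (integralD_EFin measurableT iU iV).
Qed.

Lemma has_meanZ U c k : has_mean U c -> has_mean (fun w => k * U w) (k * c).
Proof.
move=> [iU EU]; split.
  by have := integrableZl measurableT k iU; apply: eq_integrable.
by rewrite EFinM -EU; exact: (integralZl measurableT iU k).
Qed.

Lemma has_meanN U c : has_mean U c -> has_mean (fun w => - U w) (- c).
Proof.
move=> /(has_meanZ (-1)); rewrite mulN1r.
by under eq_fun do rewrite mulN1r.
Qed.

Lemma has_meanB U V c c' : has_mean U c -> has_mean V c' ->
  has_mean (fun w => U w - V w) (c - c').
Proof. by move=> mU /has_meanN; exact: has_meanD. Qed.

Lemma has_mean_sum (I : Type) (r : seq I) (Q : pred I) (U : I -> Omega -> R) (c : I -> R) :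
  (forall i, Q i -> has_mean (U i) (c i)) ->
  has_mean (fun w => \sum_(i <- r | Q i) U i w) (\sum_(i <- r | Q i) c i).
Proof.
move=> mU; elim: r => [|i r IH].
  by under eq_fun do rewrite big_nil; rewrite big_nil; exact: has_mean_cst.
under eq_fun do rewrite big_cons; rewrite big_cons.
by case: ifPn => // Qi; apply: has_meanD => //; exact: mU.
Qed.

Lemma has_mean_le U V c c' : has_mean U c -> has_mean V c' ->
  (forall w, U w <= V w) -> c <= c'.
Proof.
move=> [iU EU] [iV EV] UV; rewrite -lee_fin -EU -EV; apply: le_integral => //.
by move=> w _; rewrite lee_fin.
Qed.

Lemma has_mean_norm U c : has_mean U c -> exists c', has_mean (fun w => `|U w|) c'.
Proof. by move=> [iU _]; apply: integrable_has_mean; exact: integrable_norm. Qed.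

Lemma has_mean_indic U c (S : set Omega) : measurable S -> has_mean U c ->
  (\int[P]_(w in S) (U w)%:E = 0)%E -> has_mean (fun w => U w * \1_S w) 0.
Proof.
move=> mS [iU _] US; split.
  have := integrableMl measurableT iU (measurable_indic mS) _.
  apply; exists 1; split=> // M M1 w _ /=; apply: le_trans (ltW M1).
  by rewrite ger0_norm // indicE; case: (_ \in _).
transitivity (\int[P]_(w in S) (U w)%:E)%E; last exact: US.
rewrite [RHS]integral_mkcond; apply: eq_integral => w _.
by rewrite patchE indicE; case: ifP => wS; rewrite ?mulr1 ?mulr0.
Qed.

(* [H] is approximated uniformly by step functions, whose level sets are the
   preimages of the intervals [j / k, (j + 1) / k[. *)
Lemma has_mean_orthogonal_ge0 (D H : Omega -> R) (c M : R) :
  has_mean D c -> measurable_fun setT H -> (forall w, 0 <= H w <= M) ->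
  (forall a b : R, (\int[P]_(w in [set w | (a <= H w < b)%R]) (D w)%:E = 0)%E) ->
  has_mean (fun w => D w * H w) 0.
Proof.
move=> mD mH HM HD.
have iDH : P.-integrable setT (EFin \o (fun w => D w * H w)).
  have := integrableMl measurableT mD.1 mH _; apply.
  exists M; split; first exact: num_real.
  move=> M' MM' w _ /=; have /andP[H0 HMw] := HM w.
  by rewrite ger0_norm // (le_trans HMw) // ltW.
have [e mDH] := integrable_has_mean iDH.
have [I mI] := has_mean_norm mD.
suff step k : `|e| <= I / k.+1%:R.
  have -> : (0 : R) = e; last exact: mDH.
  apply/esym/eqP; rewrite -normr_le0 leNgt; apply/negP => e0.
  have := step (Num.truncn (I / `|e|)); rewrite ler_pdivlMr ?ltr0n // mulrC.
  by rewrite -ler_pdivlMr // leNgt truncnS_gt.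
have k0 : 0 < k.+1%:R :> R by rewrite ltr0n.
pose S (j : nat) := [set w | j%:R / k.+1%:R <= H w < j.+1%:R / k.+1%:R].
pose L := (Num.truncn (M * k.+1%:R)).+1.
have mS j : measurable (S j).
  have -> : S j = H @^-1` `[j%:R / k.+1%:R, j.+1%:R / k.+1%:R[%classic.
    by apply/seteqP; split=> w /=; rewrite in_itv.
  by rewrite -[X in measurable X]setTI; apply: mH => //; exact: measurable_itv.
pose Hk w : R := \sum_(j < L) j%:R / k.+1%:R * \1_(S j) w.
have Hk_approx w : 0 <= H w - Hk w <= 1 / k.+1%:R.
  have /andP[H0 HMw] := HM w.
  pose j0 := Num.truncn (H w * k.+1%:R).
  have Hk0 : 0 <= H w * k.+1%:R by rewrite mulr_ge0.
  have SE j : w \in S j = (j0 == j).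
    rewrite /j0 truncn_eq //; apply/idP/idP; rewrite inE /S /=;
    by rewrite ler_pdivrMr // ltr_pdivlMr.
  have j0L : (j0 < L)%N by rewrite ltnS le_truncn // ler_wpM2r.
  have -> : Hk w = j0%:R / k.+1%:R.
    rewrite /Hk (bigD1 (Ordinal j0L)) //= big1 => [|j jj0].
      by rewrite addr0 indicE SE eqxx mulr1.
    rewrite indicE SE; case: eqP => [jE|]; last by rewrite mulr0.
    by move: jj0; rewrite -val_eqE /= -jE eqxx.
  have /andP[h1 h2] := truncn_itv Hk0.
  rewrite subr_ge0 ler_pdivrMr // h1 /= lerBlDr -mulrDl ler_pdivlMr //.
  by rewrite addrC natr1 ltW.
have mDHk : has_mean (fun w => D w * Hk w) 0.
  have -> : (fun w => D w * Hk w) =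
      fun w => \sum_(j < L) j%:R / k.+1%:R * (D w * \1_(S j) w).
    by apply/funext => w; rewrite mulr_sumr; apply: eq_bigr => j _; rewrite mulrCA.
  have sum0 : \sum_(j < L) (0 : R) = 0 by rewrite big1.
  rewrite -[X in has_mean _ X]sum0; apply: has_mean_sum => j _.
  have := has_meanZ (j%:R / k.+1%:R) (has_mean_indic (mS j) mD (HD _ _)).
  by rewrite mulr0.
have mdiff := has_meanB mDH mDHk; rewrite subr0 in mdiff.
have mbnd := has_meanZ (1 / k.+1%:R) mI.
have -> : I / k.+1%:R = 1 / k.+1%:R * I by rewrite mul1r mulrC.
have bnd w : `|D w * H w - D w * Hk w| <= 1 / k.+1%:R * `|D w|.
  have /andP[h1 h2] := Hk_approx w.
  by rewrite -mulrBr normrM mulrC ler_wpM2r // ger0_norm.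
rewrite ler_norml lerNl; apply/andP; split.
- apply: (has_mean_le (has_meanN mdiff) mbnd) => w.
  by apply: le_trans (bnd w); rewrite -normrN ler_norm.
- apply: (has_mean_le mdiff mbnd) => w; exact: le_trans (ler_norm _) (bnd w).
Qed.

End Mean.

(** * Moments of the stochastic gradients *)

Section Oracle.
Context {R : realType} {disp : measure_display} {Omega : measurableType disp}.
Variable P : probability Omega R.

(** Adding [M] makes [H] nonnegative, and the shift contributes nothing because [D] has mean
    zero. *)
Lemma has_mean_orthogonal (D H : Omega -> R) (c M : R) :
  has_mean P D c -> measurable_fun setT H -> (forall w, `|H w| <= M) ->
  (\int[P]_w (D w)%:E = 0)%E ->
  (forall a b : R, (\int[P]_(w in [set w | (a <= H w < b)%R]) (D w)%:E = 0)%E) ->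
  has_mean P (fun w => D w * H w) 0.
Proof.
move=> mD mH HM D0 HD.
have -> : (fun w => D w * H w) = fun w => D w * (H w + M) - M * D w.
  by apply/funext => w; ring.
rewrite -[X in has_mean _ _ X](subrr 0) -[X in has_mean _ _ (_ - X)](mulr0 M).
apply: has_meanB; last by apply: has_meanZ; split; [exact: mD.1 | exact: D0].
apply: (has_mean_orthogonal_ge0 (M := M + M) mD).
- by apply: measurable_funD => //; exact: measurable_cst.
- move=> w; have := HM w; rewrite ler_norml => /andP[h1 h2].
  by rewrite -lerBlDr sub0r h1 lerD2r.
- move=> a b; rewrite -[RHS](HD (a - M) (b - M)); congr (integral _ _ _).
  by apply/seteqP; split=> w /=; rewrite lerBlDr ltrBrDr.
Qed.

Section Unbiased.
Context {d : nat}.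
Variables (N : 'cV[R]_d -> R) (G : set (set Omega)) (g gr : Omega -> 'cV[R]_d) (L : R).
Hypothesis GT : G setT.
Hypothesis ub : unbiased_bounded P N G g gr L.

Lemma unbiased_integral k (S : set Omega) : measurable S -> G S ->
  (\int[P]_(w in S) (gr w k 0 - g w k 0)%:E = 0)%E.
Proof.
move=> mS GS; have [ig igr _ /(_ S GS) gS] := ub.1 k.
have igS : P.-integrable S (EFin \o (fun w => g w k 0)).
  by apply: (integrableS measurableT mS) ig.
have igrS : P.-integrable S (EFin \o (fun w => gr w k 0)).
  by apply: (integrableS measurableT mS) igr.
have -> : (\int[P]_(w in S) (gr w k 0 - g w k 0)%:E =
    \int[P]_(w in S) (gr w k 0)%:E - \int[P]_(w in S) (g w k 0)%:E)%E.
  exact: (integralB_EFin mS igrS igS).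
rewrite gS subee //; exact: (integrable_fin_num mS igrS).
Qed.

Lemma unbiased_mean k : has_mean P (fun w => gr w k 0 - g w k 0) 0.
Proof.
have [ig igr _ _] := ub.1 k; split; last by apply: unbiased_integral.
have := integrableB measurableT igr ig; apply: eq_integrable => //.
Qed.

Lemma second_moment_le : exists2 c, c <= L ^+ 2 &
  has_mean P (fun w => dual_norm N (g w) ^+ 2) c.
Proof.
have [_ [V [[iq iV _ /(_ _ GT) qV] VL]]] := ub.
have [c mq] := integrable_has_mean iq.
exists c => //.
(* The bound on [V] holds only almost everywhere; truncation makes it pointwise without changing the
   integral. *)
pose V' w := Num.min (V w) (L ^+ 2).
have mV : measurable_fun setT V by apply/measurable_EFinP; exact: measurable_int iV.
have mV' : measurable_fun setT V'.
  by apply: measurable_minr => //; exact: measurable_cst.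
have VV' : (\int[P]_w (V w)%:E = \int[P]_w (V' w)%:E)%E.
  apply: ae_eq_integral => //; [exact/measurable_EFinP | exact/measurable_EFinP |].
  by apply: filterS VL => w VLw _; rewrite /V' (min_idPl VLw).
rewrite -lee_fin -mq.2 qV VV'.
apply: le_trans (le_integral_pointwise _ (g := cst (L ^+ 2)%:E) _) _.
  by move=> w; rewrite lee_fin /V' ge_min lexx orbT.
by rewrite integral_cst // [X in (_ * X)%E]probability_setT mule1.
Qed.

Lemma unbiased_dotv_mean a : has_mean P (fun w => dotv (gr w - g w) a) 0.
Proof.
have -> : (fun w => dotv (gr w - g w) a) =
    fun w => \sum_k a k 0 * (gr w k 0 - g w k 0).
  apply/funext => w; apply: eq_bigr => k _; by rewrite !mxE mulrC.
have sum0 : \sum_(k < d) a k 0 * (0 : R) = 0 by rewrite big1 // => k _; rewrite mulr0.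
rewrite -[X in has_mean _ _ X]sum0; apply: has_mean_sum => k _.
exact/has_meanZ/unbiased_mean.
Qed.

End Unbiased.

(* Jensen for a deterministic gradient [gr]: integrate
   [2 e <g, a> <= e^2 + <g, a>^2 <= e^2 + ||g||_*^2] with [e = <gr, a>]. *)
Lemma unbiased_dual_norm_le d (N : 'cV[R]_d -> R) (G : set (set Omega))
    (g : Omega -> 'cV[R]_d) (gr : 'cV[R]_d) (L : R) :
  is_norm N -> 0 <= L -> G setT ->
  unbiased_bounded P N G g (fun=> gr) L -> dual_norm N gr <= L.
Proof.
move=> nN L0 GT ub; apply: sup_le_ub; first by exists (dotv gr 0), 0; rewrite //= norm0.
move=> _ [a /= a1 <-]; set e := dotv gr a.
have [e0|e0] := lerP e 0; first exact: le_trans e0 L0.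
have [c cL mq] := second_moment_le GT ub.
have mg : has_mean P (fun w => dotv (g w) a) e.
  have := has_meanB (has_mean_cst P e) (unbiased_dotv_mean GT ub a).
  rewrite subr0; congr (has_mean P _ _); apply/funext => w.
  by rewrite dotvBl /e opprB addrC subrK.
have := has_mean_le (has_meanZ (2 * e) mg) (has_meanD (has_mean_cst P (e ^+ 2)) mq).
have pw w : 2 * e * dotv (g w) a <= e ^+ 2 + dual_norm N (g w) ^+ 2.
  have h1 := dotv_le nN (g w) a; have h2 := dotv_le nN (g w) (- a).
  rewrite dotvNr norm_opp // in h2.
  have D0 := dual_norm_ge0 nN (g w); have Na0 := norm_ge0 nN a.
  have : dotv (g w) a ^+ 2 <= dual_norm N (g w) ^+ 2.
    have h3 : dual_norm N (g w) * N a <= dual_norm N (g w) by rewrite ler_piMr.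
    nra.
  by have := sqr_ge0 (e - dotv (g w) a); nra.
move=> /(_ pw) h; rewrite -(ler_pXn2r (n:=2)) ?nnegrE //; last exact: ltW.
by nra.
Qed.

Section RunMean.
Context {n d : nat}.
Variables (N : 'cV[R]_d -> R) (X : set 'cV[R]_d) (MX L : R) (A : nat -> 'M[R]_n)
  (T : nat) (x1 : 'I_n -> 'cV[R]_d) (p : iterates (R := R) Omega n d)
  (G : nat -> set (set Omega)) (g gr : 'I_n -> nat -> Omega -> 'cV[R]_d).
Hypothesis normN : is_norm N.
Hypothesis diamX : diam_le N X MX.
Hypothesis rand_p : random_iterates p.
Hypothesis GT : forall t, G t setT.
Hypothesis Gpred : forall t j k (S : set R), (1 <= t)%N -> measurable S ->
  G t ((fun w => predicted p j t w k 0) @^-1` S).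
Hypothesis p1 : forall i w, decision p i 1 w = x1 i.
Hypothesis pS : forall i t w, (1 <= t <= T)%N ->
  decision p i t.+1 w = \sum_j A t i j *: predicted p j t w.
Hypothesis Xpred : forall i t w, (1 <= t <= T)%N -> X (predicted p i t w).
Hypothesis ub : forall i t, (1 <= t <= T)%N ->
  unbiased_bounded P N (G t.-1) (g i t) (gr i t) L.

Variable u : 'cV[R]_d.
Hypothesis Xu : X u.

Let predicted_mean i j t k : (1 <= t)%N -> (t.+1 <= T)%N ->
  has_mean P (fun w => (gr i t.+1 w k 0 - g i t.+1 w k 0) * predicted p j t w k 0) 0.
Proof.
move=> t1 tT; have ubt := @ub i t.+1 tT.
have tT' : (1 <= t <= T)%N by rewrite t1 ltnW.
have [c c0 hc] := coord_le_norm normN.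
have mH : measurable_fun setT (fun w => predicted p j t w k 0).
  by have [_ _ _] := rand_p j t; exact.
(* The predicted points stay within [MX] of [u], which bounds their coordinates uniformly. *)
apply: (@has_mean_orthogonal _ (fun w => predicted p j t w k 0) 0 (c * (MX + N u))).
- exact: (unbiased_mean (@GT _) ubt).
- exact: mH.
- move=> w; apply: le_trans (hc _ _) _; rewrite ler_wpM2l ?(ltW c0) //.
  rewrite -[predicted p j t w](subrK u); apply: le_trans (normD normN _ _) _.
  by rewrite lerD2r; apply: diamX => //; exact: Xpred.
- by apply: (unbiased_integral ubt) => //; exact: GT.
- move=> a b.
  have SE : [set w | (a <= predicted p j t w k 0 < b)%R] =
      (fun w => predicted p j t w k 0) @^-1` `[a, b[%classic.
    by apply/seteqP; split=> w /=; rewrite in_itv.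
  rewrite SE; apply: (unbiased_integral ubt).
    by rewrite -[X in measurable X]setTI; apply: mH => //; exact: measurable_itv.
  by apply: Gpred => //; exact: measurable_itv.
Qed.

Lemma run_gap_mean i t : (1 <= t <= T)%N ->
  has_mean P (fun w => dotv (gr i t w - g i t w) (decision p i t w - u)) 0.
Proof.
move=> tT; under eq_fun do rewrite dotvBr.
rewrite -[X in has_mean _ _ X](subrr 0); apply: has_meanB; last first.
  exact: (unbiased_dotv_mean (@GT _) (ub i tT)).
case: t tT => [//|[|t]] tT.
  (* In round 1 there is no earlier round to expand, but the decisions are constant. *)
  under eq_fun do rewrite p1.
  exact: (unbiased_dotv_mean (@GT _) (ub i tT)).
have tT' : (1 <= t.+1 <= T)%N by rewrite /= ltnW.
have -> : (fun w => dotv (gr i t.+2 w - g i t.+2 w) (decision p i t.+2 w)) =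
    fun w => \sum_k \sum_j A t.+1 i j *
      ((gr i t.+2 w k 0 - g i t.+2 w k 0) * predicted p j t.+1 w k 0).
  apply/funext => w; apply: eq_bigr => k _; rewrite pS // !mxE summxE mulr_sumr.
  by apply: eq_bigr => j _; rewrite !mxE mulrCA.
have sum0 : \sum_(k < d) \sum_(j < n) A t.+1 i j * (0 : R) = 0.
  by rewrite big1 // => k _; rewrite big1 // => j _; rewrite mulr0.
rewrite -[X in has_mean _ _ X]sum0; apply: has_mean_sum => k _.
apply: has_mean_sum => j _; apply: has_meanZ; exact: predicted_mean.
Qed.

End RunMean.
End Oracle.

(** * Expected regret *)

Section MeanLe.
Context {R : realType} {disp : measure_display} {Omega : measurableType disp}.
Variable P : probability Omega R.

(** The oracle bounds the second moments without giving their values, so the exact mean is left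
    existential. *)
Definition mean_le (U : Omega -> R) (c : R) : Prop :=
  exists2 c', c' <= c & has_mean P U c'.

Lemma mean_leD U V c c' : mean_le U c -> mean_le V c' ->
  mean_le (fun w => U w + V w) (c + c').
Proof.
move=> [a ac mU] [b bc mV]; exists (a + b); first exact: lerD.
exact: has_meanD.
Qed.

Lemma mean_leZ k U c : 0 <= k -> mean_le U c -> mean_le (fun w => k * U w) (k * c).
Proof.
move=> k0 [a ac mU]; exists (k * a); first by rewrite ler_wpM2l.
exact: has_meanZ.
Qed.

Lemma mean_le_cst c : mean_le (fun=> c) c.
Proof. by exists c => //; exact: has_mean_cst. Qed.

Lemma mean_le_sum (I : Type) (r : seq I) (Q : pred I) (U : I -> Omega -> R) (c : I -> R) :
  (forall i, Q i -> mean_le (U i) (c i)) ->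
  mean_le (fun w => \sum_(i <- r | Q i) U i w) (\sum_(i <- r | Q i) c i).
Proof.
move=> mU; elim: r => [|i r IH].
  by under eq_fun do rewrite big_nil; rewrite big_nil; exact: mean_le_cst.
under eq_fun do rewrite big_cons; rewrite big_cons.
by case: ifPn => // Qi; apply: mean_leD => //; exact: mU.
Qed.

Lemma mean_le_sum_nat T (U : nat -> Omega -> R) (c : nat -> R) :
  (forall t, (1 <= t <= T)%N -> mean_le (U t) (c t)) ->
  mean_le (fun w => \sum_(1 <= t < T.+1) U t w) (\sum_(1 <= t < T.+1) c t).
Proof.
move=> mU; under eq_fun do rewrite big_nat; rewrite big_nat.
by apply: mean_le_sum => t; rewrite ltnS; exact: mU.
Qed.

Lemma expectation_le_mean (phi U : Omega -> R) c :
  (forall w, phi w <= U w) -> mean_le U c -> ('E_P[phi] <= c%:E)%E.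
Proof.
move=> phiU [c' c'c [_ EU]]; rewrite unlock.
apply: (@le_trans _ _ c'%:E); last by rewrite lee_fin.
by rewrite -EU; apply: le_integral_pointwise => w; rewrite lee_fin.
Qed.

Lemma expectation_ge_mean (phi U : Omega -> R) c :
  (forall w, - phi w <= U w) -> mean_le U c -> ((- c)%:E <= 'E_P[phi])%E.
Proof.
move=> phiU [c' c'c mU]; rewrite unlock.
have [_ EU] := has_meanN mU.
apply: (@le_trans _ _ (- c')%:E); first by rewrite lee_fin lerN2.
by rewrite -EU; apply: le_integral_pointwise => w; rewrite lee_fin lerNl.
Qed.

End MeanLe.

Section OneSided.
Context {R : realType} {disp : measure_display} {Omega : measurableType disp}.
Variable P : probability Omega R.
Context {n d m : nat}.
Variables (T : nat) (Nx : 'cV[R]_d -> R) (Ny : 'cV[R]_m -> R).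
Variables (X : set 'cV[R]_d) (Y : set 'cV[R]_m).
Variables (f : 'I_n -> nat -> 'cV[R]_d -> 'cV[R]_m -> R).
Variables (xs : nat -> 'cV[R]_d) (ys : nat -> 'cV[R]_m).
Variables (LX LY rhox rhoy G Mx dx1 dy1 Sx1 Sy1 : R) (alpha eta : nat -> R).
Variables (px : iterates (R := R) Omega n d) (py : iterates (R := R) Omega n m).
Variables (gx : 'I_n -> nat -> Omega -> 'cV[R]_d) (gy : 'I_n -> nat -> Omega -> 'cV[R]_m).
Hypothesis normNx : is_norm Nx.
Hypothesis normNy : is_norm Ny.
Hypothesis cvxY : convex_set Y.
Hypothesis cvxf : forall i t y, (1 <= t)%N -> convex_on_space (fun x => f i t x y).
Hypothesis ccvf : forall i t x, (1 <= t)%N -> convex_on_space (fun y => - f i t x y).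
Hypothesis difffx : forall i t x y, (1 <= t)%N -> X x -> Y y ->
  differentiable_at (fun x' => f i t x' y) x.
Hypothesis difffy : forall i t x y, (1 <= t)%N -> X x -> Y y ->
  differentiable_at (fun y' => f i t x y') y.
Hypothesis saddle : forall t, (1 <= t)%N ->
  saddle_point X Y (total_payoff f t) (xs t) (ys t).
Hypothesis LX0 : 0 <= LX.
Hypothesis LY0 : 0 <= LY.
Hypothesis rhox0 : 0 < rhox.
Hypothesis rhoy0 : 0 < rhoy.
Hypothesis G0 : 0 <= G.
Hypothesis alpha0 : forall t, (1 <= t <= T)%N -> 0 < alpha t.
Hypothesis eta0 : forall t, (1 <= t <= T)%N -> 0 < eta t.
Hypothesis gradx_le : forall i t x y, (1 <= t <= T)%N -> X x -> Y y ->
  dual_norm Nx (grad (fun x' => f i t x' y) x) <= LX.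
Hypothesis grady_le : forall i t x y, (1 <= t <= T)%N -> X x -> Y y ->
  dual_norm Ny (grad (fun y' => f i t x y') y) <= LY.
Hypothesis Xp : forall i t w, (1 <= t <= T)%N -> X (decision px i t w).
Hypothesis Yp : forall i t w, (1 <= t <= T)%N -> Y (decision py i t w).
Hypothesis mirrorx : forall w,
  \sum_(1 <= t < T.+1) \sum_i dotv (gx i t w) (decision px i t w - xs t)
  <= \sum_(1 <= t < T.+1) \sum_i alpha t * dual_norm Nx (gx i t w) ^+ 2 / (2 * rhox) + Mx.
Hypothesis consx : forall w,
  \sum_(1 <= t < T.+1) \sum_i Nx (decision px i t w - average (fun i => decision px i t w))
  <= dx1 + G * (n%:R * (Sx1
       + \sum_(1 <= t < T.+1) \sum_i alpha t * dual_norm Nx (gx i t w) / rhox)).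
Hypothesis consy : forall w,
  \sum_(1 <= t < T.+1) \sum_i Ny (decision py i t w - average (fun i => decision py i t w))
  <= dy1 + G * (n%:R * (Sy1
       + \sum_(1 <= t < T.+1) \sum_i eta t * dual_norm Ny (gy i t w) / rhoy)).

Let gradx i t w :=
  grad (fun x' => f i t x' (decision py i t w)) (decision px i t w).

Hypothesis gap_mean : forall i t, (1 <= t <= T)%N ->
  has_mean P (fun w => dotv (gradx i t w - gx i t w) (decision px i t w - xs t)) 0.
Hypothesis moment_x : forall i t, (1 <= t <= T)%N ->
  mean_le P (fun w => dual_norm Nx (gx i t w) ^+ 2) (LX ^+ 2).
Hypothesis moment_y : forall i t, (1 <= t <= T)%N ->
  mean_le P (fun w => dual_norm Ny (gy i t w) ^+ 2) (LY ^+ 2).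

Let energy {d'} (N : 'cV[R]_d' -> R) (g : 'I_n -> nat -> Omega -> 'cV[R]_d')
    (a : nat -> R) (rho : R) w :=
  \sum_(1 <= t < T.+1) \sum_i a t / (2 * rho) * dual_norm N (g i t w) ^+ 2.

Let energy_mean d' (N : 'cV[R]_d' -> R) g a rho L : 0 < rho ->
  (forall t, (1 <= t <= T)%N -> 0 < a t) ->
  (forall i t, (1 <= t <= T)%N -> mean_le P (fun w => dual_norm N (g i t w) ^+ 2) (L ^+ 2)) ->
  mean_le P (energy N g a rho) (n%:R * L ^+ 2 / (2 * rho) * \sum_(1 <= t < T.+1) a t).
Proof.
move=> rho0 a0 mom.
have -> : n%:R * L ^+ 2 / (2 * rho) * \sum_(1 <= t < T.+1) a t =
    \sum_(1 <= t < T.+1) \sum_(i < n) a t / (2 * rho) * L ^+ 2.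
  rewrite mulr_sumr; apply: eq_bigr => t _; rewrite sumr_const card_ord -[RHS]mulr_natl.
  by ring.
apply: mean_le_sum_nat => t tT; apply: mean_le_sum => i _.
by apply: mean_leZ; [rewrite divr_ge0 ?mulr_ge0 // ltW ?a0 | exact: mom].
Qed.

(* [L D <= (D^2 + L^2) / 2] *)
Let energy_ge d' (N : 'cV[R]_d' -> R) g a rho L w : 0 < rho ->
  (forall t, (1 <= t <= T)%N -> 0 < a t) ->
  L * \sum_(1 <= t < T.+1) \sum_i a t * dual_norm N (g i t w) / rho
  <= energy N g a rho w + n%:R * L ^+ 2 / (2 * rho) * \sum_(1 <= t < T.+1) a t.
Proof.
move=> rho0 a0; rewrite !mulr_sumr -big_split /=; apply: ler_sum_nat => t tT.
have at0 : 0 < a t by apply: a0.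
have -> : n%:R * L ^+ 2 / (2 * rho) * a t = \sum_(i < n) a t / (2 * rho) * L ^+ 2.
  by rewrite sumr_const card_ord -[RHS]mulr_natl; ring.
rewrite mulr_sumr -big_split /=; apply: ler_sum => i _.
set D := dual_norm _ _.
have : 0 <= a t / (2 * rho) * (D - L) ^+ 2.
  by rewrite mulr_ge0 ?sqr_ge0 // divr_ge0 ?mulr_ge0 // ltW.
have -> : a t / (2 * rho) * (D - L) ^+ 2 =
  a t / (2 * rho) * D ^+ 2 + a t / (2 * rho) * L ^+ 2 - L * (a t * D / rho).
  by field; rewrite gt_eqF.
lra.
Qed.

(** The first player alone contributes mirror-step terms, through [Mx] and the sum of [alpha]; the
    second enters only by its consensus error, so every occurrence of [eta] carries [G]. The
    majorant [U] is returned because its integrability, unlike that of the regret, is known. *)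
Lemma one_sided_regret j : exists U : Omega -> R,
  (forall w, \sum_(1 <= t < T.+1)
      total_payoff f t (decision px j t w) (decision py j t w)
    - \sum_(1 <= t < T.+1) total_payoff f t (xs t) (ys t) <= U w) /\
  mean_le P U
    ((n%:R + 2) * (LX * dx1 + LY * dy1)
     + G * (n%:R * (n%:R + 2) * (LX * Sx1 + LY * Sy1))
     + (n%:R * LX ^+ 2 / rhox + G * (n%:R ^+ 2 * (n%:R + 2) * LX ^+ 2 / rhox))
        * \sum_(1 <= t < T.+1) alpha t
     + G * (n%:R ^+ 2 * (n%:R + 2) * LY ^+ 2 / rhoy) * \sum_(1 <= t < T.+1) eta t
     + Mx).
Proof.
(* Factor of the summed mirror displacements once the consensus bound is multiplied by n + 2. *)
pose kappa := (n%:R + 2) * (G * n%:R).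
have kappa0 : 0 <= kappa by rewrite !mulr_ge0 ?addr_ge0.
pose gap w := \sum_(1 <= t < T.+1) \sum_i
  dotv (gradx i t w - gx i t w) (decision px i t w - xs t).
pose Lx := n%:R * LX ^+ 2 / (2 * rhox) * \sum_(1 <= t < T.+1) alpha t.
pose Ly := n%:R * LY ^+ 2 / (2 * rhoy) * \sum_(1 <= t < T.+1) eta t.
pose C := (n%:R + 2) * (LX * dx1 + LY * dy1)
     + kappa * (LX * Sx1 + LY * Sy1) + kappa * (Lx + Ly) + Mx.
exists (fun w => gap w + (1 + kappa) * energy Nx gx alpha rhox w
  + kappa * energy Ny gy eta rhoy w + C); split=> [w|].
- have saddle_gap :
    \sum_(1 <= t < T.+1) total_payoff f t (decision px j t w) (decision py j t w)
    - \sum_(1 <= t < T.+1) total_payoff f t (xs t) (ys t)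
    <= \sum_(1 <= t < T.+1) (\sum_i dotv (gradx i t w) (decision px i t w - xs t)
     + (n%:R + 2) * (LX * \sum_i Nx (decision px i t w - average (fun i => decision px i t w))
     + LY * \sum_i Ny (decision py i t w - average (fun i => decision py i t w)))).
    rewrite -sumrB; apply: ler_sum_nat => t tT; have /andP[t1 _] := tT.
    apply: (@saddle_gap_le R n d m Nx Ny X Y (fun i => f i t) LX LY normNx normNy cvxY
      LX0 LY0 _ _ _ _ _ _ _ _ _ (fun i => decision px i t w) (fun i => decision py i t w)).
    + by move=> i y; exact: cvxf.
    + by move=> i x; exact: ccvf.
    + by move=> i x y; exact: difffx.
    + by move=> i x y; exact: difffy.
    + by move=> i x y; exact: gradx_le.
    + by move=> i x y; exact: grady_le.
    + exact: saddle.
    + by move=> i; exact: Xp.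
    + by move=> i; exact: Yp.
  apply: le_trans saddle_gap _.
  rewrite big_split /= -mulr_sumr big_split /= -!mulr_sumr.
  have gapE : \sum_(1 <= t < T.+1) \sum_i dotv (gradx i t w) (decision px i t w - xs t)
     = gap w + \sum_(1 <= t < T.+1) \sum_i dotv (gx i t w) (decision px i t w - xs t).
    rewrite -big_split; apply: eq_bigr => t _ /=; rewrite -big_split; apply: eq_bigr => i _ /=.
    by rewrite dotvBl subrK.
  have mx := mirrorx w.
  have energyE : energy Nx gx alpha rhox w =
    \sum_(1 <= t < T.+1) \sum_i alpha t * dual_norm Nx (gx i t w) ^+ 2 / (2 * rhox).
    by apply: eq_bigr => t _; apply: eq_bigr => i _; rewrite mulrAC.
  rewrite -energyE in mx.
  have cx := ler_wpM2l LX0 (consx w); have cy := ler_wpM2l LY0 (consy w).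
  have ex := energy_ge Nx gx LX w rhox0 alpha0.
  have ey := energy_ge Ny gy LY w rhoy0 eta0.
  rewrite gapE -/Lx -/Ly in ex ey *.
  have n2 : 0 <= n%:R + 2 :> R by rewrite addr_ge0.
  have := ler_wpM2l n2 (lerD cx cy); have := ler_wpM2l kappa0 (lerD ex ey).
  move: mx; rewrite /C /kappa; lra.
(* The mirror step costs only half of the stated term n LX^2 / rhox; the spare [Lx] added to [C] is
   the other half. *)
- have -> : (n%:R + 2) * (LX * dx1 + LY * dy1)
     + G * (n%:R * (n%:R + 2) * (LX * Sx1 + LY * Sy1))
     + (n%:R * LX ^+ 2 / rhox + G * (n%:R ^+ 2 * (n%:R + 2) * LX ^+ 2 / rhox))
        * \sum_(1 <= t < T.+1) alpha t
     + G * (n%:R ^+ 2 * (n%:R + 2) * LY ^+ 2 / rhoy) * \sum_(1 <= t < T.+1) eta t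
     + Mx = 0 + (1 + kappa) * Lx + kappa * Ly + (C + Lx).
    by rewrite /C /Lx /Ly /kappa; field; rewrite !gt_eqF.
  have Lx0 : 0 <= Lx.
    rewrite mulr_ge0 ?divr_ge0 ?mulr_ge0 ?sqr_ge0 ?(ltW rhox0) //.
    by rewrite big_nat sumr_ge0 // => t tT; rewrite ltW // alpha0.
  apply: mean_leD; last by exists C; [rewrite lerDl | exact: has_mean_cst].
  apply: mean_leD; last first.
    by apply: mean_leZ => //; exact: energy_mean.
  apply: mean_leD; last first.
    by apply: mean_leZ; [rewrite addr_ge0 | exact: energy_mean].
  have sum0 : \sum_(1 <= t < T.+1) \sum_(i < n) (0 : R) = 0.
    by rewrite big1 // => t _; rewrite big1.
  rewrite -[X in mean_le _ _ X]sum0; apply: mean_le_sum_nat => t tT.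
  by apply: mean_le_sum => i _; exists 0 => //; exact: gap_mean.
Qed.

End OneSided.

Section History.
Context {R : realType} {disp : measure_display} {Omega : measurableType disp} {n d m : nat}.
Variables (px : iterates (R := R) Omega n d) (py : iterates (R := R) Omega n m).
Variables (gx : 'I_n -> nat -> Omega -> 'cV[R]_d) (gy : 'I_n -> nat -> Omega -> 'cV[R]_m).

Lemma historyT t : history px py gx gy t [set: Omega].
Proof.
by rewrite -(setD0 [set: Omega]); apply: sigma_algebraCD; exact: sigma_algebra0.
Qed.

Lemma history_predicted_x t j k (S : set R) : (1 <= t)%N -> measurable S ->
  history px py gx gy t ((fun w => predicted px j t w k 0) @^-1` S).
Proof.
move=> t1 mS; apply: sub_sigma_algebra; exists t; first by rewrite /= t1 leqnn.
by left; exists j => //; right; exists k => //; exists S => //; rewrite setTI.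
Qed.

Lemma history_predicted_y t j k (S : set R) : (1 <= t)%N -> measurable S ->
  history px py gx gy t ((fun w => predicted py j t w k 0) @^-1` S).
Proof.
move=> t1 mS; apply: sub_sigma_algebra; exists t; first by rewrite /= t1 leqnn.
by right; exists j => //; right; exists k => //; exists S => //; rewrite setTI.
Qed.

End History.

Theorem theorem1 (R : realType) (disp : measure_display)
    (Omega : measurableType disp) (P : probability Omega R)
    (n d m T Q : nat)
    (* problem *)
    (Nx : 'cV[R]_d -> R) (Ny : 'cV[R]_m -> R)
    (X : set 'cV[R]_d) (Y : set 'cV[R]_m) (MX MY : R)
    (f : 'I_n -> nat -> 'cV[R]_d -> 'cV[R]_m -> R)
    (xs : nat -> 'cV[R]_d) (ys : nat -> 'cV[R]_m)
    (* network *)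
    (E : nat -> rel 'I_n) (A : nat -> 'M[R]_n) (zeta : R)
    (* mirror maps *)
    (Rx : 'cV[R]_d -> R) (Ry : 'cV[R]_m -> R) (rhox rhoy KX KY : R)
    (* algorithm *)
    (x1 : 'I_n -> 'cV[R]_d) (y1 : 'I_n -> 'cV[R]_m)
    (alpha eta : nat -> R) (B : nat -> 'M[R]_d) (C : nat -> 'M[R]_m)
    (Gx : 'I_n -> nat -> 'cV[R]_d -> 'cV[R]_m -> Omega -> 'cV[R]_d)
    (Gy : 'I_n -> nat -> 'cV[R]_d -> 'cV[R]_m -> Omega -> 'cV[R]_m)
    (LX LY : R) (px : iterates Omega n d) (py : iterates Omega n m) :
  is_norm Nx -> is_norm Ny ->
  convex_set X -> compact X -> 0 < MX -> diam_le Nx X MX ->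
  convex_set Y -> compact Y -> 0 < MY -> diam_le Ny Y MY ->
  (forall i t, (1 <= t)%N ->
     (forall y, convex_on_space (fun x => f i t x y)) /\
     (forall x, convex_on_space (fun y => - f i t x y))) ->
  (forall i t x y, (1 <= t)%N -> X x -> Y y ->
     differentiable_at (fun x' => f i t x' y) x /\
     differentiable_at (fun y' => f i t x y') y) ->
  (forall t, (1 <= t)%N -> saddle_point X Y (total_payoff f t) (xs t) (ys t)) ->
  0 < zeta -> zeta < 1 -> weighted_network E A zeta ->
  0 < rhox -> (forall x, differentiable_at Rx x) ->
  strongly_convex Nx X rhox Rx ->
  0 < rhoy -> (forall y, differentiable_at Ry y) ->
  strongly_convex Ny Y rhoy Ry ->
  (* algorithm *)
  (forall i, X (x1 i)) -> (forall i, Y (y1 i)) ->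
  (forall t, (1 <= t <= T)%N -> 0 < alpha t /\ 0 < eta t) ->
  (forall t, (1 <= t < T)%N -> alpha t.+1 <= alpha t /\ eta t.+1 <= eta t) ->
  random_iterates px -> random_iterates py ->
  mirror_run X Rx E A B alpha T x1 (fun i t w => - realized Gx px py i t w) px ->
  mirror_run Y Ry E A C eta T y1 (realized Gy px py) py ->
  (* Assumption 1 *)
  (0 < Q)%N -> jointly_connected E Q ->
  (* Assumption 2 *)
  0 <= LX -> 0 <= LY ->
  stochastic_oracle P Nx Ny X Y f Gx Gy px py T LX LY ->
  (* Assumption 3 *)
  bregman_lipschitz Nx X Rx KX -> bregman_lipschitz Ny Y Ry KY ->
  bregman_convex_right n Rx -> bregman_convex_right n Ry ->
  (* Assumption 4 *)
  (forall t, (1 <= t <= T)%N ->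
     good_prediction Nx X Rx (B t) /\ good_prediction Ny Y Ry (C t)) ->
  (2 <= T)%N ->
  forall j : 'I_n,
  let nR : R := n%:R in
  let Gam := (1 - zeta / (4 * nR ^+ 2)) `^ ((1 - 2 * Q%:R) / Q%:R) in
  let sig := (1 - zeta / (4 * nR ^+ 2)) `^ (1 / Q%:R) in
  let I1 := (nR + 2) * \sum_(i < n)
      (LX * Nx (x1 i - average x1) + LY * Ny (y1 i - average y1)) in
  let I2 := nR * (nR + 2) * \sum_(i < n) (LX * Nx (x1 i) + LY * Ny (y1 i)) in
  let I3 := nR * LX ^+ 2 / rhox in
  let I4 := nR ^+ 2 * (nR + 2) * LX ^+ 2 / rhox in
  let I5 := nR * LY ^+ 2 / rhoy in
  let I6 := nR ^+ 2 * (nR + 2) * LY ^+ 2 / rhoy in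
  let RX := bregman_max Rx X in
  let RY := bregman_max Ry Y in
  (esp_regret P f xs ys px py T j <=
   (I1 + Gam / (1 - sig) * I2
    + (I3 + Gam / (1 - sig) * I4) * \sum_(1 <= t < T.+1) alpha t
    + (I5 + Gam / (1 - sig) * I6) * \sum_(1 <= t < T.+1) eta t
    + nR * RX / alpha T + nR * RY / eta T
    + nR * KX * \sum_(1 <= t < T.+1) (alpha t)^-1 * Nx (xs t.+1 - B t *m xs t)
    + nR * KY * \sum_(1 <= t < T.+1) (eta t)^-1 * Ny (ys t.+1 - C t *m ys t)
   )%:E)%E.
Proof.
move=> nNx nNy cvxX _ _ diamX cvxY _ _ diamY ccf dff sad zeta0 zeta1 net
  rhox0 diffRx scRx rhoy0 diffRy scRy Xx1 Yy1 step0 step_decr randx randy runx runy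
  Q0 conn LX0 LY0 oracle lipx lipy cvxrx cvxry pred T2 j; lazy zeta.
set Gam := (_ `^ ((1 - 2 * Q%:R) / Q%:R)); set sig := (_ `^ (1 / Q%:R)).
have T1 : (1 <= T)%N by exact: ltnW.
have alpha0 t (tT : (1 <= t <= T)%N) : 0 < alpha t := (step0 t tT).1.
have eta0 t (tT : (1 <= t <= T)%N) : 0 < eta t := (step0 t tT).2.
have alpha_decr t (tT : (1 <= t < T)%N) : alpha t.+1 <= alpha t := (step_decr t tT).1.
have eta_decr t (tT : (1 <= t < T)%N) : eta t.+1 <= eta t := (step_decr t tT).2.
have predx t (tT : (1 <= t <= T)%N) : good_prediction Nx X Rx (B t) := (pred t tT).1.
have predy t (tT : (1 <= t <= T)%N) : good_prediction Ny Y Ry (C t) := (pred t tT).2.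
have Xxs t : (1 <= t)%N -> X (xs t) by move=> /sad[].
have Yys t : (1 <= t)%N -> Y (ys t) by move=> /sad[].
have Xp := run_decision_in_horizon cvxX net predx Xx1 runx.
have Yp := run_decision_in_horizon cvxY net predy Yy1 runy.
pose F := history px py (realized Gx px py) (realized Gy px py).
have FT t : F t [set: Omega] by exact: historyT.
(* At fixed points the true gradient is deterministic, so the oracle bounds it everywhere on X x Y;
   the clause at the current decisions is used for the second moments and for orthogonality. *)
have gradx_le i t x y : (1 <= t <= T)%N -> X x -> Y y ->
    dual_norm Nx (grad (fun x' => f i t x' y) x) <= LX.
  move=> tT Xx Yy; have [/(_ x y Xx Yy)[ub _] _] := oracle i t tT.
  exact: (unbiased_dual_norm_le nNx LX0 (FT t.-1) ub).
have grady_le i t x y : (1 <= t <= T)%N -> X x -> Y y ->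
    dual_norm Ny (grad (fun y' => f i t x y') y) <= LY.
  move=> tT Xx Yy; have [/(_ x y Xx Yy)[_ ub] _] := oracle i t tT.
  exact: (unbiased_dual_norm_le nNy LY0 (FT t.-1) ub).
have ubx i t (tT : (1 <= t <= T)%N) := (oracle i t tT).2.1.
have uby i t (tT : (1 <= t <= T)%N) := (oracle i t tT).2.2.
have momx i t : (1 <= t <= T)%N ->
    mean_le P (fun w => dual_norm Nx (- - realized Gx px py i t w) ^+ 2) (LX ^+ 2).
  by move=> tT; under eq_fun do rewrite opprK; exact: second_moment_le (FT _) (ubx i t tT).
have momy i t : (1 <= t <= T)%N ->
    mean_le P (fun w => dual_norm Ny (- realized Gy px py i t w) ^+ 2) (LY ^+ 2).
  move=> tT; under eq_fun do rewrite dual_norm_opp //.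
  exact: second_moment_le (FT _) (uby i t tT).
have gapx i t (tT : (1 <= t <= T)%N) := run_gap_mean nNx diamX randx FT
  (@history_predicted_x _ _ _ _ _ _ px py _ _) (run_init runx)
  (run_decision_predicted net runx) (run_predicted_in predx runx) ubx
  (Xxs t (proj1 (andP tT))) i tT.
have gapy i t (tT : (1 <= t <= T)%N) := run_gap_mean nNy diamY randy FT
  (@history_predicted_y _ _ _ _ _ _ px py _ _) (run_init runy)
  (run_decision_predicted net runy) (run_predicted_in predy runy) uby
  (Yys t (proj1 (andP tT))) i tT.
have mirrorx w := run_mirror_total nNx cvxX diamX net rhox0 diffRx scRx lipx cvxrx predx
  alpha0 alpha_decr Xx1 runx w T1 Xxs.
have mirrory w := run_mirror_total nNy cvxY diamY net rhoy0 diffRy scRy lipy cvxry predy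
  eta0 eta_decr Yy1 runy w T1 Yys.
have consx w := run_consensus_total nNx cvxX zeta0 zeta1 net Q0 conn rhox0 diffRx scRx predx
  alpha0 Xx1 runx j w T1.
have consy w := run_consensus_total nNy cvxY zeta0 zeta1 net Q0 conn rhoy0 diffRy scRy predy
  eta0 Yy1 runy j w T1.
pose G := Gam / (1 - sig).
have G0 : 0 <= G.
  by rewrite divr_ge0 ?powR_ge0 // subr_ge0 ltW // consensus_rate_lt1.
have [|U1 [phiU1 mU1]] := one_sided_regret nNx nNy cvxY
  (fun i t y t1 => (ccf i t t1).1 y) (fun i t x t1 => (ccf i t t1).2 x)
  (fun i t x y t1 Xx Yy => (dff i t x y t1 Xx Yy).1)
  (fun i t x y t1 Xx Yy => (dff i t x y t1 Xx Yy).2)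
  sad LX0 LY0 rhox0 rhoy0 G0 alpha0 eta0 gradx_le grady_le Xp Yp
  mirrorx consx consy _ momx momy j.
  by move=> i t tT; under eq_fun do rewrite opprK; exact: gapx.
(* The lower bound is the upper bound for the game with payoffs [- f] and exchanged players. *)
pose f' i t y x := - f i t x y.
have total_opp t y x : total_payoff f' t y x = - total_payoff f t x y
  by rewrite /total_payoff sumrN.
have ccf1' i t x : (1 <= t)%N -> convex_on_space (fun y => f' i t y x).
  by move=> t1; exact: (ccf i t t1).2.
have ccf2' i t y : (1 <= t)%N -> convex_on_space (fun x => - f' i t y x).
  by move=> t1; rewrite /f'; under eq_fun do rewrite opprK; exact: (ccf i t t1).1.
have dff1' i t y x : (1 <= t)%N -> Y y -> X x -> differentiable_at (fun y' => f' i t y' x) y.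
  by move=> t1 Yy Xx; apply: differentiable_at_opp; exact: (dff i t x y t1 Xx Yy).2.
have dff2' i t y x : (1 <= t)%N -> Y y -> X x -> differentiable_at (fun x' => f' i t y x') x.
  by move=> t1 Yy Xx; apply: differentiable_at_opp; exact: (dff i t x y t1 Xx Yy).1.
have sad' t : (1 <= t)%N -> saddle_point Y X (total_payoff f' t) (ys t) (xs t).
  move=> t1; have [Xs Ys sd] := sad t t1; split=> // y x Yy Xx.
  by rewrite !total_opp !lerN2; have [h1 h2] := sd x y Xx Yy.
have grad1' i t y x : (1 <= t <= T)%N -> Y y -> X x ->
    dual_norm Ny (grad (fun y' => f' i t y' x) y) <= LY.
  move=> tT Yy Xx; have /andP[t1 _] := tT.
  rewrite grad_opp; last exact: (dff i t x y t1 Xx Yy).2.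
  by rewrite dual_norm_opp //; exact: grady_le.
have grad2' i t y x : (1 <= t <= T)%N -> Y y -> X x ->
    dual_norm Nx (grad (fun x' => f' i t y x') x) <= LX.
  move=> tT Yy Xx; have /andP[t1 _] := tT.
  rewrite grad_opp; last exact: (dff i t x y t1 Xx Yy).1.
  by rewrite dual_norm_opp //; exact: gradx_le.
have [|U2 [phiU2 mU2]] := one_sided_regret nNy nNx cvxX ccf1' ccf2' dff1' dff2' sad' LY0 LX0
  rhoy0 rhox0 G0 eta0 alpha0 grad1' grad2' Yp Xp mirrory consy consx _ momy momx j.
  move=> i t tT; have /andP[t1 _] := tT.
  have := has_meanN (gapy i t tT); rewrite oppr0.
  congr (has_mean P _ _); apply/funext => w.
  rewrite grad_opp; last exact: (dff i t _ _ t1 (Xp i t w tT) (Yp i t w tT)).2.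
  by rewrite -dotvNl opprD.
pose phi w := \sum_(1 <= t < T.+1) total_payoff f t (decision px j t w) (decision py j t w)
  - \sum_(1 <= t < T.+1) total_payoff f t (xs t) (ys t).
have phiU2' w : - phi w <= U2 w.
  apply: le_trans (phiU2 w); rewrite /phi opprB -!sumrB.
  by apply: ler_sum => t _; rewrite !total_opp opprK addrC.
set bound := (X in (_ <= X%:E)%E).
(* Each one-sided bound lacks the divergence, drift and plain step-size terms of the other player.
   These are nonnegative, so [bound] dominates both. *)
have RX0 : 0 <= n%:R * bregman_max Rx X / alpha T.
  rewrite divr_ge0 ?mulr_ge0 ?(bregman_max_ge0 nNx diamX lipx (Xx1 j)) //.
  by rewrite ltW // alpha0 // T1 leqnn.
have RY0 : 0 <= n%:R * bregman_max Ry Y / eta T.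
  rewrite divr_ge0 ?mulr_ge0 ?(bregman_max_ge0 nNy diamY lipy (Yy1 j)) //.
  by rewrite ltW // eta0 // T1 leqnn.
have KX0 : 0 <= n%:R * KX * \sum_(1 <= t < T.+1) (alpha t)^-1 * Nx (xs t.+1 - B t *m xs t).
  rewrite mulr_sumr big_nat sumr_ge0 // => t tT; have /andP[t1 _] := tT.
  rewrite mulrCA mulr_ge0 ?invr_ge0 ?(ltW (alpha0 _ tT)) // -mulrA mulr_ge0 //.
  apply: (bregman_lipschitz_ge0 lipx); first exact: Xxs.
  by have [_ _ stab] := predx t tT; apply/stab/Xxs.
have KY0 : 0 <= n%:R * KY * \sum_(1 <= t < T.+1) (eta t)^-1 * Ny (ys t.+1 - C t *m ys t).
  rewrite mulr_sumr big_nat sumr_ge0 // => t tT; have /andP[t1 _] := tT.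
  rewrite mulrCA mulr_ge0 ?invr_ge0 ?(ltW (eta0 _ tT)) // -mulrA mulr_ge0 //.
  apply: (bregman_lipschitz_ge0 lipy); first exact: Yys.
  by have [_ _ stab] := predy t tT; apply/stab/Yys.
have sum_alpha0 : 0 <= n%:R * LX ^+ 2 / rhox * \sum_(1 <= t < T.+1) alpha t.
  rewrite mulr_ge0 ?divr_ge0 ?mulr_ge0 ?sqr_ge0 ?(ltW rhox0) //.
  by rewrite big_nat sumr_ge0 // => t tT; exact/ltW/alpha0.
have sum_eta0 : 0 <= n%:R * LY ^+ 2 / rhoy * \sum_(1 <= t < T.+1) eta t.
  rewrite mulr_ge0 ?divr_ge0 ?mulr_ge0 ?sqr_ge0 ?(ltW rhoy0) //.
  by rewrite big_nat sumr_ge0 // => t tT; exact/ltW/eta0.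
have split_sum (a b : 'I_n -> R) :
    \sum_i (LX * a i + LY * b i) = LX * \sum_i a i + LY * \sum_i b i.
  by rewrite big_split /= -!mulr_sumr.
have le1 := expectation_le_mean phiU1 mU1.
have ge1 := expectation_ge_mean phiU2' mU2.
have : ('E_P[phi] <= bound%:E)%E.
  apply: le_trans le1 _; rewrite lee_fin /bound !split_sum -/G; lra.
have : ((- bound)%:E <= 'E_P[phi])%E.
  apply: le_trans ge1; rewrite lee_fin lerN2 /bound !split_sum -/G; lra.
(* The two finite bounds exclude infinite values of the expectation. *)
rewrite /esp_regret -/phi; case: ('E_P[phi])%E => [r| |] //=.
by rewrite !lee_fin ler_norml => -> ->.
Qed.
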